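(* For $n\ge 1$ let $\gamma_n(q)=T_n(q)^{1/(2n)}$ for $q\in(-1,1)$ (positive real root), where $T_n(q)=\sum_{\pi\in\mathcal P(2n)}q^{\mathrm{cr}(\pi)}$. Let $B_{\mathbb C}=\{z\in\mathbb C:|z|<1\}$. For every $n\ge1$, the function $$q\mapsto \frac{1}{(1-q)^n}\sum_{k=-n}^{n}(-1)^k q^{k(k-1)/2}\binom{2n}{n+k}$$ admits an analytic $2n$-th root $\tilde\gamma_n$ on $B_{\mathbb C}$ which coincides with $\gamma_n$ on $(-1,1)$. Moreover $\tilde\gamma_n(q)\to \dfrac{2}{\sqrt{1-q}}$ (principal branch of the square root) for every $q\in B_{\mathbb C}$, and the convergence is uniform on compact subsets of $B_{\mathbb C}$.
   Context: A pairing of $[2n]=\{1,\dots,2n\}$ is a partition of $[2n]$ into $n$ two-element blocks; $\mathcal P(2n)$ denotes the set of all pairings of $[2n]$. Two blocks $\{a,b\}$ ($a<b$) and $\{c,d\}$ ($c<d$) cross if $a<c<b<d$ or $c<a<d<b$; $\mathrm{cr}(\pi)$ is the number of unordered pairs of blocks of $\pi$ that cross. By the Touchard–Riordan formula (a known result), $T_n(q)=\frac{1}{(1-q)^n}\sum_{k=-n}^{n}(-1)^k q^{k(k-1)/2}\binom{2n}{n+k}$ for all $q$ with $q\neq 1$. The quantity $\gamma_n(q)$ is the $2n$-norm of the $q$-semicircular operator, and $\lim_n\gamma_n(q)$ is its operator norm. *)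

(* Defs.v *)
From mathcomp Require Import all_boot.
From Stdlib Require Import Reals.
Set Implicit Arguments. Unset Strict Implicit. Unset Printing Implicit Defensive.

Definition is_pairing (n : nat) (P : {set {set 'I_(2*n)}}) : bool :=
  partition P [set: 'I_(2*n)] && [forall B in P, #|B| == 2].

Definition crossb (m : nat) (B C : {set 'I_m}) : bool :=
  [exists a : 'I_m, exists b : 'I_m, exists c : 'I_m, exists d : 'I_m,
     [&& B == [set a; b], C == [set c; d], (a < b)%N, (c < d)%N &
         ((a < c < b)%N && (b < d)%N) || ((c < a < d)%N && (d < b)%N)]].

Definition cr (m : nat) (P : {set {set 'I_m}}) : nat :=
  #|[set S : {set {set 'I_m}} | [&& S \subset P, #|S| == 2 &
        [exists B, exists C, (S == [set B; C]) && crossb B C]]]|.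

Open Scope R_scope.

Definition T (n : nat) (q : R) : R :=
  \big[Rplus/0]_(P : {set {set 'I_(2*n)}} | is_pairing P) q ^ cr P.

Definition gamma (n : nat) (q : R) : R := Rpower (T n q) (/ INR (2 * n)).

Definition Cx : Type := (R * R)%type.
Definition Cre (z : R) : Cx := (z, 0).
Definition Cadd (z w : Cx) : Cx := (fst z + fst w, snd z + snd w).
Definition Copp (z : Cx) : Cx := (- fst z, - snd z).
Definition Csub (z w : Cx) : Cx := Cadd z (Copp w).
Definition Cmul (z w : Cx) : Cx :=
  (fst z * fst w - snd z * snd w, fst z * snd w + snd z * fst w).
Definition Cinv (z : Cx) : Cx :=
  let d := fst z * fst z + snd z * snd z in (fst z / d, - snd z / d).
Definition Cdiv (z w : Cx) : Cx := Cmul z (Cinv w).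
Fixpoint Cpow (z : Cx) (k : nat) : Cx :=
  match k with O => (1, 0) | S k' => Cmul z (Cpow z k') end.
Definition Cnorm (z : Cx) : R := sqrt (fst z * fst z + snd z * snd z).

Definition Csqrt (z : Cx) : Cx :=
  (sqrt ((Cnorm z + fst z) / 2),
   (if Rle_dec 0 (snd z) then 1 else -1) * sqrt ((Cnorm z - fst z) / 2)).

Definition in_disk (z : Cx) : Prop := Cnorm z < 1.

Fixpoint Csum (f : nat -> Cx) (N : nat) : Cx :=
  match N with O => (0, 0) | S N' => Cadd (Csum f N') (f N') end.

Definition analytic_on_disk (f : Cx -> Cx) : Prop :=
  forall z0, in_disk z0 ->
    exists r, 0 < r /\ exists a : nat -> Cx,
      forall z, Cnorm (Csub z z0) < r ->
        Un_cv (fun N => Cnorm (Csub (Csum (fun k => Cmul (a k) (Cpow (Csub z z0) k)) N) (f z))) 0.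

(** The Touchard--Riordan expression
    F_n(q) = (1-q)^{-n} sum_{k=-n}^{n} (-1)^k q^{k(k-1)/2} binom(2n, n+k),
    written with j = n + k ranging over 0..2n. *)
Definition TR (n : nat) (q : Cx) : Cx :=
  Cdiv (Csum (fun j =>
          let k := (Z.of_nat j - Z.of_nat n)%Z in
          Cmul (Cre ((-1) ^ Z.abs_nat k * INR ('C(2 * n, j))))
               (Cpow q (Z.to_nat (k * (k - 1) / 2)))) (2 * n + 1))
       (Cpow (Csub (1, 0) q) n).

Definition Copen (U : Cx -> Prop) : Prop :=
  forall z, U z -> exists e, 0 < e /\ forall w, Cnorm (Csub w z) < e -> U w.

Definition Ccompact (K : Cx -> Prop) : Prop :=
  forall (I : Type) (U : I -> Cx -> Prop),
    (forall i, Copen (U i)) -> (forall z, K z -> exists i, U i z) ->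
    exists l : list I, forall z, K z -> exists i, List.In i l /\ U i z.

(* Main.v *)
(* Write N_n for the numerator of the Touchard-Riordan expression. Pairing the indices k and 1 - k,
   N_n(q) = \sum_(0 <= j <= n) (-1)^j b_(n,j) q^(j (j + 1) / 2) with the ballot numbers
   b_(n,j) = C(2n, n + j) - C(2n, n + j + 1).

   Nonvanishing. The numbers b_(n,j) satisfy
   2 (n + 1) (2n + 1) b_(n,j) = ((n + 1) (n + 2) - j (j + 1)) b_(n+1,j), that is,
   2 (n + 1) (2n + 1) N_n = (n + 1) (n + 2) N_(n+1) - 2 q N_(n+1)'. If N_(n+1) has no zero in
   |q| < r, then Re (q N_(n+1)' / N_(n+1)) <= deg N_(n+1) / 2 = (n + 1) (n + 2) / 4 there, so that
   N_n has no zero either. On the other hand f_n = N_n / b_(n,0) tends, in every weighted l^1 norm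
   \sum_k |a_k| r^k with r < 1, to \sum_j (-1)^j (2j + 1) q^(j (j + 1) / 2), which is the cube of
   \prod_(m >= 1) (1 - q^m) by Jacobi and hence invertible for that norm. So f_n has no zero in
   |q| < r for n large, and descending in n it has none in the unit disk for any n.

   The root. The formal series f_n is exp (\sum_k p_k q^k / k) with -p_k the k-th power sum of the
   inverses of the roots, so |p_k| <= deg f_n and the formal 2n-th root of f_n / (1 - q)^n
   converges in the unit disk. The invertibility of f_n for the l^1 norms, uniform in n, bounds
   |p_k| r^k uniformly in n, whence f_n^(1/(2n)) -> 1, while b_(n,0)^(1/(2n)) -> 2.

   The formula itself. Reading a pairing from left to right gives paths whose down-steps from
   height h have weight 1 + q + ... + q^(h - 1); the resulting recursion is solved in terms of
   ballot numbers and Gaussian binomials. *)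
Require Import Defs.
From mathcomp Require Import all_boot all_order all_algebra ring lra zify.
Import Order.TTheory GRing.Theory Num.Theory.
Set Implicit Arguments. Unset Strict Implicit. Unset Printing Implicit Defensive.

(** * Triangular numbers *)

Definition tri (j : nat) : nat := 'C(j.+1, 2).

Lemma triS j : tri j.+1 = (tri j + j.+1)%N.
Proof. by rewrite /tri binS bin1. Qed.

Lemma leq_tri j : (j <= tri j)%N.
Proof. by elim: j => // j IH; rewrite triS addnC leq_addr. Qed.

Lemma tri_double j : (2 * tri j = j * j.+1)%N.
Proof. by elim: j => [|j IH] //; rewrite triS mulnDr IH; ring. Qed.

Lemma tri_inj : injective tri.
Proof.
move=> i j ij; have := tri_double i; rewrite ij tri_double => /eqP.
by case: (ltngtP i j) => // h; nia.
Qed.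

(** * Gaussian binomial coefficients *)

Section Gauss.
Local Open Scope ring_scope.
Variables (K : comNzRingType) (q : K).

(** The Gaussian binomial, defined by the q-Pascal rule because its quotient formula makes no sense
    over an arbitrary commutative ring. *)
Fixpoint gauss (n k : nat) : K :=
  match n, k with
  | _, 0%N => 1
  | 0%N, k'.+1 => 0
  | n'.+1, k'.+1 => gauss n' k' + q ^+ k * gauss n' k
  end.

Lemma gauss0 n : gauss n 0 = 1. Proof. by case: n. Qed.

Lemma gaussS n k : gauss n.+1 k.+1 = gauss n k + q ^+ k.+1 * gauss n k.+1.
Proof. by []. Qed.

Lemma gauss_small n k : (n < k)%N -> gauss n k = 0.
Proof.
by elim: n k => [|n IH] [|k] //= nk; rewrite !IH ?mulr0 ?addr0 //; lia.
Qed.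

Lemma gauss_nn n : gauss n n = 1.
Proof. by elim: n => [//|n IH]; rewrite gaussS IH gauss_small // mulr0 addr0. Qed.

(** The quotient of neighbouring Gaussian binomials, cleared of denominators. It accounts for the
    difference between the two q-Pascal rules. *)
Lemma gauss_ratio n k : (k <= n)%N ->
  (1 - q ^+ k.+1) * gauss n k.+1 = (1 - q ^+ (n - k)) * gauss n k.
Proof.
elim: n k => [|n IH] [|k] // kn.
- by rewrite subrr mul0r mulr0.
- rewrite gaussS gauss0 subn0 !gauss0 mulr1.
  have := IH 0%N (leq0n _); rewrite subn0 gauss0 mulr1 => h.
  rewrite mulrDr mulr1 [_ * (q ^+ 1 * _)]mulrCA h (exprS q n); ring.
- have {}kn : (k <= n)%N by [].
  have h := IH k kn.
  have [kn'|kn'] := ltnP k n; last first.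
    have -> : k = n by lia.
    rewrite subnn subrr mul0r gauss_small ?mulr0 //.
  have h1 := IH k.+1 kn'.
  rewrite gaussS mulrDr [_ * (_ * gauss _ _)]mulrCA h1 gaussS subSS.
  rewrite mulrDr -h.
  have e : q ^+ (n - k) = q * q ^+ (n - k.+1) by rewrite -exprS; congr (_ ^+ _); lia.
  rewrite e !exprS; ring.
Qed.

(** Subtracting the defining q-Pascal rule leaves exactly [gauss_ratio]. *)
Lemma gaussS' n k : (k <= n)%N ->
  gauss n.+1 k.+1 = q ^+ (n - k) * gauss n k + gauss n k.+1.
Proof.
move=> kn.
have h : (1 - q ^+ k.+1) * gauss n k.+1 - (1 - q ^+ (n - k)) * gauss n k = 0.
  by rewrite gauss_ratio // subrr.
by apply/subr0_eq; rewrite gaussS -[RHS]oppr0 -h; ring.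
Qed.

Lemma gauss_absorb n k : (k <= n)%N ->
  (1 - q ^+ k.+1) * gauss n.+1 k.+1 = (1 - q ^+ n.+1) * gauss n k.
Proof.
move=> kn; rewrite gaussS mulrDr [_ * (_ * gauss _ _)]mulrCA gauss_ratio //.
have -> : q ^+ n.+1 = q ^+ k.+1 * q ^+ (n - k) by rewrite -exprD; congr (_ ^+ _); lia.
ring.
Qed.

Definition qpoch n : K := \prod_(i < n) (1 - q ^+ i.+1).

Lemma gauss_qpoch n k : gauss (n + k) k * qpoch k = \prod_(i < k) (1 - q ^+ (n + i.+1)).
Proof.
elim: k => [|k IH]; first by rewrite gauss0 /qpoch !big_ord0 mulr1.
rewrite /qpoch !big_ord_recr /= -/(qpoch k) -IH addnS.
transitivity (qpoch k * ((1 - q ^+ k.+1) * gauss (n + k).+1 k.+1)); first by rewrite /=; ring.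
by rewrite gauss_absorb ?leq_addl //; ring.
Qed.

(** One use of each q-Pascal rule. It describes how the middle coefficients of row 2m + 1 evolve
    with m. *)
Lemma gauss_step n k : (k <= n)%N ->
  gauss n.+2 k.+1 = (1 + q ^+ n.+1) * gauss n k + q ^+ k.+1 * gauss n k.+1
    + (if k is k'.+1 then q ^+ (n - k') * gauss n k' else 0).
Proof.
move=> kn; rewrite gaussS (gaussS' kn).
have e : q ^+ n.+1 = q ^+ k.+1 * q ^+ (n - k) by rewrite -exprD; congr (_ ^+ _); lia.
case: k kn e => [|k] kn e; first by rewrite !gauss0 e; ring.
by rewrite (@gaussS' n k) 1?ltnW // e; ring.
Qed.

End Gauss.

(** * Jacobi's identity for the cube of the product of the 1 - q^m *)

Section Jacobi.
Local Open Scope ring_scope.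
Variable F : fieldType.
Local Notation q := ('X : {poly F}).

(** Row 2m + 1 read from its middle outwards. The guard is needed because [m - j] truncates at 0,
    where [gauss] is 1 and not 0. *)
Let cc m j : {poly F} := if (j <= m)%N then gauss q m.*2.+1 (m - j) else 0.

Lemma one_subXn_neq0 k : 1 - q ^+ k.+1 != 0.
Proof.
apply/eqP => /(congr1 (horner^~ 0)) /eqP.
by rewrite !hornerE expr0n subr0 oner_eq0.
Qed.

Let cc_rec m j : cc m.+1 j.+1 =
  (1 + q ^+ m.+1.*2) * cc m j.+1 + q ^+ (m - j) * cc m j + q ^+ (m + j + 3) * cc m j.+2.
Proof.
rewrite /cc ltnS; case: (ltngtP j m) => [jm|mj|->].
- rewrite subSS.
  have -> : (m - j = (m - j.+1).+1)%N by lia.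
  rewrite doubleS gauss_step; last by lia.
  congr (_ + _ + _); case: ltnP => h; last first.
    have -> : (m - j.+1 = 0)%N by lia.
    by rewrite mulr0.
  have -> : (m - j.+1 = (m - j.+2).+1)%N by lia.
  by congr (q ^+ _ * gauss q _ _); lia.
- by rewrite ifF ?mulr0 ?addr0 //; lia.
- by rewrite !subnn !gauss0 ifF ?mulr0 ?addr0 ?add0r ?mulr1 //; lia.
Qed.

Let cc_rec0 m : cc m.+1 0 =
  (1 + q ^+ m.+1.*2 + q ^+ m.+1) * cc m 0 + q ^+ (m + 2) * cc m 1.
Proof.
rewrite /cc !subn0 doubleS gauss_step; last by lia.
(* The neighbour on the other side of the middle equals the middle coefficient, by symmetry of an
   odd row; it supplies the extra [q ^+ m.+1]. *)
have -> : gauss q m.*2.+1 m.+1 = gauss q m.*2.+1 m.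
  have /gauss_ratio h : (m <= m.*2.+1)%N by lia.
  apply: (mulfI (one_subXn_neq0 m)); rewrite h; congr ((1 - q ^+ _) * _); lia.
congr (_ + _); first by rewrite /= !mulrDl.
case: m => [|m]; first by rewrite mulr0.
rewrite ltn0Sn subn1; congr (q ^+ _ * gauss q _ _); lia.
Qed.

(* The finite form at [z = 1] of the Jacobi triple product, divided by [1 - z]. *)
Lemma jacobi_finite m N : (m < N)%N ->
  \sum_(j < N) (j.*2.+1%:R * ((-1) ^+ j * q ^+ tri j * cc m j)) = qpoch q m ^+ 2.
Proof.
elim: m N => [|m IH] [//|N] mN.
  rewrite big_ord_recl big1 => [|i _]; last by rewrite /cc /= !mulr0.
  by rewrite /cc subnn gauss0 /qpoch big_ord0 !mulr1 addr0 expr1n.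
pose t j := (-1) ^+ j * q ^+ tri j * cc m j.
have t_small j : (m < j)%N -> t j = 0.
  by move=> mj; rewrite /t /cc leqNgt mj /= mulr0.
have S M : (m < M)%N -> \sum_(j < M) (j.*2.+1%:R * t j) = qpoch q m ^+ 2 by exact: IH.
(* The sign and [tri] absorb the dependence on j: both outer neighbours enter with the same
   coefficient [- q ^+ m.+1]. *)
have TS j : (-1) ^+ j.+1 * q ^+ tri j.+1 * cc m.+1 j.+1 =
    (1 + q ^+ m.+1.*2) * t j.+1 - q ^+ m.+1 * t j - q ^+ m.+1 * t j.+2.
  rewrite cc_rec /t !triS; have [mj|jm] := ltnP m j.
    by rewrite /cc !ifF ?mulr0 ?addr0 ?subr0 ?mulr0 //; lia.
  have -> : q ^+ m.+1 = q ^+ (m - j) * q ^+ j.+1 by rewrite -exprD; congr (q ^+ _); lia.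
  have -> : q ^+ (m + j + 3) = q ^+ (m - j) * q ^+ j.+1 * q ^+ j.+2.
    by rewrite -!exprD; congr (q ^+ _); lia.
  by rewrite !exprD !(exprS (-1)); ring.
have T0 : cc m.+1 0 = (1 + q ^+ m.+1.*2) * t 0%N + q ^+ m.+1 * t 0%N - q ^+ m.+1 * t 1%N.
  rewrite cc_rec0 /t !expr0 expr1 !mul1r addn2 (exprS q m.+1); ring.
rewrite big_ord_recl /= expr0 !mul1r T0.
under eq_bigr => i _ do rewrite /bump leq0n add1n TS !mulrBr.
rewrite !sumrB.
have e1 : t 0%N + \sum_(j < N) (j.+1.*2.+1%:R * t j.+1) = qpoch q m ^+ 2.
  by rewrite -(S N.+1) 1?ltnW // big_ord_recl /= mul1r.
(* The shifted sums give t_j the weights 2j + 3 and 2j - 1, which add up to 2 (2j + 1). The sum for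
   m + 1 is thus 1 - 2 q^(m + 1) + q^(2m + 2), a square, times the sum for m. *)
have e2 : \sum_(j < N) (j.+1.*2.+1%:R * t j) + (\sum_(j < N) (j.+1.*2.+1%:R * t j.+2)
    + t 1%N - t 0%N) = qpoch q m ^+ 2 *+ 2.
  have -> : \sum_(j < N) (j.+1.*2.+1%:R * t j) = \sum_(j < N.+2) (j.+1.*2.+1%:R * t j).
    by rewrite !big_ord_recr /= !t_small ?mulr0 ?addr0 //; lia.
  have -> : \sum_(j < N) (j.+1.*2.+1%:R * t j.+2) + t 1%N - t 0%N
      = \sum_(j < N.+2) ((j.*2%:R - 1) * t j).
    rewrite !big_ord_recl /= sub0r mulN1r.
    under [in RHS]eq_bigr => i _ do rewrite /bump !leq0n !add1n.
    have -> : \sum_(i < N) (i.+2.*2%:R - 1) * t i.+2 = \sum_(i < N) (i.+1.*2.+1%:R * t i.+2).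
      by apply: eq_bigr => i _; rewrite !doubleS !mulrS; ring.
    by change (bump 0 0) with 1%N; change (1.*2%:R) with (2%:R : {poly F}); ring.
  rewrite -big_split -(S N.+2) ?mulr2n -?big_split /=; last by lia.
  by apply: eq_bigr => j _; rewrite !doubleS !mulrS; ring.
under eq_bigr => i _ do rewrite mulrCA.
under [X in _ - X - _]eq_bigr => i _ do rewrite mulrCA.
under [X in _ - X]eq_bigr => i _ do rewrite mulrCA.
rewrite -!mulr_sumr.
have -> : qpoch q m.+1 ^+ 2 = (1 + q ^+ m.+1.*2) * (qpoch q m ^+ 2)
    - q ^+ m.+1 * (qpoch q m ^+ 2 *+ 2).
  by rewrite /qpoch big_ord_recr /= -addnn exprD; ring.
by rewrite -{1}e1 -e2; ring.
Qed.


Lemma prod_one_subXn s n (e : nat -> nat) : (forall i, (i < n)%N -> (s <= e i)%N) ->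
  exists h, \prod_(i < n) (1 - q ^+ e i) = 1 + q ^+ s * h.
Proof.
elim: n => [|n IH] he; first by exists 0; rewrite big_ord0 mulr0 addr0.
have [h eh] := IH (fun i hi => he i (ltnW hi)).
exists (h - (1 + q ^+ s * h) * q ^+ (e n - s)).
rewrite big_ord_recr /= eh -{1}(subnKC (he n (ltnSn n))) exprD; ring.
Qed.

(** By [gauss_qpoch] the left side is a product of factors 1 - q^e with e > m - j. This controls the
    passage from the finite identity to Jacobi's series. *)
Let qpoch_cc m j : (j <= m)%N -> exists h, qpoch q m * cc m j = 1 + q ^+ (m - j).+1 * h.
Proof.
move=> jm.
have -> : qpoch q m = qpoch q (m - j) * \prod_(i < j) (1 - q ^+ (m - j + i).+1).
  have e n : qpoch q (n + j) = qpoch q n * \prod_(i < j) (1 - q ^+ (n + i).+1).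
    by rewrite /qpoch big_split_ord.
  by rewrite -e subnK.
have -> : qpoch q (m - j) * \prod_(i < j) (1 - q ^+ (m - j + i).+1) * cc m j =
    \prod_(i < m - j) (1 - q ^+ (m + j.+1 + i.+1)) * \prod_(i < j) (1 - q ^+ (m - j + i).+1).
  have := @gauss_qpoch _ q (m + j.+1) (m - j).
  have -> : (m + j.+1 + (m - j) = m.*2.+1)%N by lia.
  by rewrite /cc jm => <-; ring.
have [|h1 ->] := @prod_one_subXn (m - j).+1 (m - j) (fun i => m + j.+1 + i.+1)%N.
  by move=> i _; lia.
have [|h2 ->] := @prod_one_subXn (m - j).+1 j (fun i => (m - j + i).+1).
  by move=> i _; lia.
by exists (h1 + h2 + q ^+ (m - j).+1 * h1 * h2); ring.
Qed.

(** Multiplying [jacobi_finite] by one more [qpoch q m] replaces [cc m j] by 1 up to an error of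
    order q^(m - j + 1); the factor q^(tri j) with [j <= tri j] pushes that error beyond degree
    m. *)
Lemma jacobi_coef m k : (k <= m)%N ->
  (qpoch q m ^+ 3)`_k = \sum_(j < m.+1 | tri j == k) (-1) ^+ j * j.*2.+1%:R.
Proof.
move=> km; rewrite exprS -(jacobi_finite (ltnSn m)) mulr_sumr coef_sum.
rewrite [RHS]big_mkcond; apply: eq_bigr => j _.
have [h eh] := qpoch_cc (leq_ord j).
have -> : qpoch q m * (j.*2.+1%:R * ((-1) ^+ j * q ^+ tri j * cc m j)) =
    ((-1) ^+ j * j.*2.+1%:R) *: q ^+ tri j
    + q ^+ (tri j + (m - j).+1) * ((-1) ^+ j * j.*2.+1%:R * h).
  rewrite exprD -mul_polyC rmorphM rmorphXn rmorphN1 rmorph_nat.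
  transitivity ((-1) ^+ j * j.*2.+1%:R * q ^+ tri j * (qpoch q m * cc m j)); first by ring.
  by rewrite eh; ring.
rewrite coefD coefZ coefXn coefXnM ifT ?addr0; last by have := leq_tri j; lia.
by rewrite eq_sym; case: eqP; rewrite ?mulr1 ?mulr0.
Qed.

End Jacobi.

(** * Crossings of partial pairings, read from left to right *)

Section Involutions.
Local Open Scope ring_scope.
Variables (K : comNzRingType) (q : K) (N : nat).
Implicit Types (s : {ffun 'I_N -> 'I_N}) (x i c : 'I_N).

(* Partial pairings of the first [m] points: involutions fixing all the points [>= m]. *)
Definition invol m s := [forall x, s (s x) == x] && [forall x : 'I_N, (m <= x)%N ==> (s x == x)].
Definition opens m s := [set c : 'I_N | (c < m)%N && (s c == c)].

(* Crossings, together with the pairs of an arc and an open point below it. *)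
Definition crossings s := [set p : 'I_N * 'I_N |
  [&& (p.1 < p.2)%N, (p.2 < s p.1)%N & (s p.1 < s p.2)%N || (s p.2 == p.2)]].
Definition weight s := #|crossings s|.

(** The number of open points plays the role of the height of a lattice path after m steps. *)
Definition wsum m h : K := \sum_(s | invol m s && (#|opens m s| == h)) q ^+ weight s.

Lemma involP m s : reflect ((forall x, s (s x) = x) /\ (forall x, (m <= x)%N -> s x = x)) (invol m s).
Proof.
apply: (iffP andP) => [[/forallP h1 /forallP h2]|[h1 h2]]; split.
- by move=> x; apply/eqP.
- by move=> x mx; apply/eqP; apply: (implyP (h2 x)).
- by apply/forallP => x; rewrite h1.
- by apply/forallP => x; apply/implyP => mx; rewrite h2.
Qed.

Lemma invol_lt m s x : invol m s -> (x < m)%N -> (s x < m)%N.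
Proof.
move=> /involP[ss sf] xm; rewrite ltnNge; apply/negP => h.
by have := sf _ h; rewrite ss => e; rewrite -e leqNgt xm in h.
Qed.

(** A new point y either stays open or closes an open point i; [link] is the second operation and
    [unlink] undoes it. *)
Definition link (y : 'I_N) s i : {ffun 'I_N -> 'I_N} :=
  [ffun x => if x == i then y else if x == y then i else s x].
Definition unlink (y : 'I_N) s : {ffun 'I_N -> 'I_N} :=
  [ffun x => if (x == y) || (s x == y) then x else s x].

Section Step.
Variables (m : nat) (y : 'I_N).
Hypothesis ym : nat_of_ord y = m.

Lemma link_spec s i : invol m s -> i \in opens m s ->
  [/\ invol m.+1 (link y s i), link y s i y = i, i != y,
      opens m.+1 (link y s i) = opens m s :\ i & unlink y (link y s i) = s].
Proof.
move=> sI; have [ss sf] := involP _ _ sI; rewrite inE => /andP[im /eqP si].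
have iy : i != y by rewrite -val_eqE /= ym neq_ltn im.
have sy : s y = y by apply: sf; rewrite ym.
have s_i x : x != i -> s x != i by apply: contraNneq => e; rewrite -(ss x) e si.
have s_y x : x != y -> s x != y by apply: contraNneq => e; rewrite -(ss x) e sy.
have ly : link y s i y = i by rewrite ffunE eq_sym (negPf iy) eqxx.
split=> //.
- apply/involP; split=> x.
    rewrite [link y s i x]ffunE; case: (altP (x =P i)) => [->|xi]; first by rewrite ly.
    case: (altP (x =P y)) => [->|xy]; first by rewrite ffunE eqxx.
    by rewrite ffunE (negPf (s_i _ xi)) (negPf (s_y _ xy)) ss.
  move=> mx; rewrite ffunE !ifF; first by rewrite sf // ltnW.
    by apply/eqP => e; rewrite e ym ltnn in mx.
  by apply/eqP => e; rewrite e ltnNge (ltnW im) in mx.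
- apply/setP => x; rewrite !inE ffunE.
  case: (altP (x =P i)) => [->|xi] /=; first by rewrite eq_sym (negPf iy) andbF.
  case: (altP (x =P y)) => [->|xy]; first by rewrite (negPf iy) ym ltnn andbF.
  by rewrite ltnS leq_eqVlt -{1}ym val_eqE (negPf xy).
- apply/ffunP => x; rewrite !ffunE.
  case: (altP (x =P y)) => [->|xy] /=; first by rewrite sy.
  case: (altP (x =P i)) => [->|xi] /=; first by rewrite eqxx si.
  by rewrite (negPf (s_y _ xy)).
Qed.

Lemma unlink_spec s : invol m.+1 s -> s y != y ->
  [/\ invol m (unlink y s), s y \in opens m (unlink y s) & link y (unlink y s) (s y) = s].
Proof.
move=> sI syy; have [ss sf] := involP _ _ sI.
have sym : (s y < m)%N.
  have := invol_lt sI (_ : (y < m.+1)%N); rewrite ym => /(_ (leqnn _)).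
  by rewrite ltnS leq_eqVlt -{1}ym val_eqE (negPf syy).
have sE x : (s x == y) = (x == s y) by apply/eqP/eqP => [<-|->]; rewrite ss.
split.
- apply/involP; split=> x.
    have uE z : unlink y s z = if (z == y) || (z == s y) then z else s z by rewrite ffunE sE.
    rewrite (uE x); case: ifP => [h|/norP[xy xsy]]; first by rewrite uE h.
    by rewrite uE sE (negPf xsy) (inj_eq (can_inj ss)) (negPf xy) ss.
  rewrite leq_eqVlt -ym val_eqE eq_sym ffunE => /predU1P[->|yx]; first by rewrite eqxx.
  by case: ifP => // _; apply: sf; rewrite -ym.
- by rewrite inE sym ffunE sE eqxx orbT eqxx.
- apply/ffunP => x; rewrite !ffunE sE; case: (altP (x =P s y)) => [->|xsy]; first by rewrite ss.
  by case: (altP (x =P y)) => [->|].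
Qed.

(** An arc over the open point i was counted with i already, and now crosses the new arc. The only
    new pairs consist of the new arc and an open point under it, that is, to the right of i. *)
Lemma weight_link s i : invol m s -> i \in opens m s ->
  weight (link y s i) = (weight s + #|[set c in opens m s | (i < c)%N]|)%N.
Proof.
move=> sI iO; have [ss sf] := involP _ _ sI.
move: (iO); rewrite inE => /andP[im /eqP si].
have iy : i != y by rewrite -val_eqE /= ym neq_ltn im.
have sy : s y = y by apply: sf; rewrite ym.
have lt_m x : (x < m)%N -> (s x < m)%N by exact: invol_lt.
have big x : (m <= x)%N -> s x = x by exact: sf.
have <- : #|[set (i, c) | c in [set c in opens m s | (i < c)%N]]| =
    #|[set c in opens m s | (i < c)%N]| by rewrite card_imset // => a b [].
rewrite /weight -cardsUI [in RHS](_ : _ :&: _ = set0) ?cards0 ?addn0; last first.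
  apply/setP => -[a c]; rewrite !inE; apply/negP => /andP[/= /and3P[ac cs _] /imsetP[d _ [ai _]]].
  by rewrite ai si ltnNge (ltnW _) // -ai in cs.
congr #|pred_of_set _|; apply/setP => -[a c]; rewrite !inE /=.
rewrite ![link y s i _]ffunE.
have -> : ((a, c) \in [set (i, c0) | c0 in [set c0 in opens m s | (i < c0)%N]]) =
    [&& a == i, (c < m)%N, s c == c & (i < c)%N].
  apply/imsetP/and4P => [[d]|[/eqP-> cm sc ic]].
    by rewrite !inE => /andP[/andP[dm sd] id] [-> ->]; split.
  by exists c; rewrite // !inE cm sc ic.
have sa_m : (a < c < s a)%N -> (s a < m)%N.
  move=> /andP[ac ca]; apply: lt_m; rewrite ltnNge; apply/negP => /big e.
  by rewrite e ltnNge (ltnW ac) in ca.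
case: (altP (a =P i)) => [->|ai] /=.
  rewrite si ym; have -> : (i < c)%N && ((c < i)%N && ((i < s c)%N || (s c == c))) = false.
    by apply/negP => /and3P[h1 h2 _]; rewrite ltnNge (ltnW h1) in h2.
  rewrite /= [in RHS]andbA [in RHS]andbC; apply/andb_id2l => ic.
  have ci : c != i by rewrite neq_ltn ic orbT.
  apply/andb_id2l => cm; have cy : c != y by rewrite -val_eqE /= ym neq_ltn cm.
  by rewrite (negPf ci) (negPf cy) [(m < _)%N]ltnNge (ltnW (lt_m _ cm)).
rewrite orbF; case: (altP (a =P y)) => [->|ay].
  rewrite sy; apply/idP/idP => /and3P[h1 h2 _].
    by have := ltn_trans (ltn_trans h1 h2) im; rewrite ym ltnn.
  by rewrite ltnNge (ltnW h1) in h2.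
apply/andb_id2l => ac; apply/andb_id2l => ca; have {}sa_m := sa_m (introT andP (conj ac ca)).
case: (altP (c =P i)) => [->|ci]; first by rewrite si eqxx orbT ym sa_m.
case: (altP (c =P y)) => [cy|//].
by have := ltn_trans ca sa_m; rewrite cy ym ltnn.
Qed.

End Step.

(** Ordered by position, the elements of A have all possible ranks; removing the least one drops the
    largest exponent. *)
Lemma sum_expr_above (A : {set 'I_N}) :
  \sum_(i in A) q ^+ #|[set c in A | (i < c)%N]| = \sum_(k < #|A|) q ^+ k.
Proof.
move En : #|A| => n; elim: n A En => [|n IH] A An.
  by rewrite big_ord0 big1 // => i; rewrite (cards0_eq An) inE.
have /card_gt0P[x0 x0A] : (0 < #|A|)%N by rewrite An.
case: (@arg_minnP _ x0 (mem A) val x0A) => a /= aA amin.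
have Aa : #|A :\ a| = n by move: An; rewrite (cardsD1 a) aA => -[].
rewrite (bigD1 a) //= big_ord_recr /= addrC; congr (_ + _).
  rewrite -(IH _ Aa) (eq_bigl (mem (A :\ a))) => [|i]; last by rewrite !inE andbC.
  apply: eq_bigr => i; rewrite !inE => /andP[ia iA]; congr (q ^+ #|pred_of_set _|).
  apply/setP => c; rewrite !inE andbC -andbA; case: (altP (c =P a)) => [->|_] /=.
    by rewrite ltnNge amin ?andbF.
  by rewrite andbC.
congr (q ^+ _); rewrite -Aa; congr #|pred_of_set _|; apply/setP => c; rewrite !inE andbC.
case: (boolP (c \in A)) => cA; last by rewrite !andbF.
by rewrite !andbT ltn_neqAle eq_sym val_eqE amin // andbT.
Qed.

(** The first summand is the case where point m stays open. Otherwise it closes one of h + 1 open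
    points, and the weight added runs through 0, ..., h. *)
Lemma wsum_rec m h : (m < N)%N -> wsum m.+1 h =
  (if h is h'.+1 then wsum m h' else 0) + (\sum_(k < h.+1) q ^+ k) * wsum m h.+1.
Proof.
move=> mN; pose y := Ordinal mN; have ym : nat_of_ord y = m by [].
rewrite /wsum (bigID (fun s => s y == y)) /=; congr (_ + _).
  have invE s : invol m.+1 s && (s y == y) = invol m s.
    apply/andP/idP => [[/involP[ss sf] /eqP sy]|sI].
      apply/involP; split=> // x; rewrite leq_eqVlt => /predU1P[e|]; last exact: sf.
      by rewrite (_ : x = y) //; apply: val_inj.
    have [ss sf] := involP _ _ sI; split; last by rewrite sf.
    by apply/involP; split=> // x mx; apply: sf; apply: ltnW.
  have opE s : invol m s -> opens m.+1 s = y |: opens m s.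
    move=> /involP[_ sf]; apply/setP => x; rewrite !inE ltnS leq_eqVlt -{1}ym val_eqE.
    by case: eqP => [->|//]; rewrite sf ?eqxx.
  have cardE s : invol m s -> #|opens m.+1 s| = #|opens m s|.+1.
    by move=> sI; rewrite opE // cardsU1 inE ym ltnn.
  case: h => [|h].
    rewrite big_pred0 // => s; rewrite andbAC invE; case: (boolP (invol m s)) => // sI.
    by rewrite cardE.
  apply: eq_bigl => s; rewrite andbAC invE; case: (boolP (invol m s)) => // sI.
  by rewrite cardE // eqSS.
rewrite mulr_sumr.
under [RHS]eq_bigr => s /andP[sI /eqP so].
  rewrite -so -sum_expr_above mulr_suml; over.
rewrite (pair_big_dep _ (fun s i => i \in opens m s)) /=.
(* Partial pairings where y is not fixed correspond to pairs of a partial pairing of the first m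
   points and one of its open points. *)
rewrite (reindex_onto (fun p => link y p.1 p.2) (fun s => (unlink y s, s y))) /=; last first.
  by move=> s /andP[/andP[sI _] sy]; have [_ _ ->] := unlink_spec ym sI sy.
apply: eq_big => [[s i]|[s i]] /=.
  apply/idP/idP => [/andP[/andP[/andP[lI lo] ly] /eqP[us li]]|/andP[/andP[sI so] iO]].
    have [uI lO _] := unlink_spec ym lI ly; rewrite us li in uI lO; rewrite uI lO !andbT /=.
    have [_ _ _ e _] := link_spec ym uI lO.
    by move: lo; rewrite e (cardsD1 i (opens m s)) lO => /eqP->.
  have [lI ly iy e ->] := link_spec ym sI iO.
  by rewrite lI ly iy e eqxx !andbT /=; move: so; rewrite (cardsD1 i (opens m s)) iO.
move=> /andP[/andP[/andP[lI lo] ly] /eqP[us li]].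
have [uI lO _] := unlink_spec ym lI ly; rewrite us li in uI lO.
by rewrite (weight_link ym uI lO) exprD mulrC.
Qed.

Lemma wsum_init h : wsum 0 h = (h == 0%N)%:R.
Proof.
have idI : invol 0 [ffun x => x] by apply/involP; split=> x; rewrite !ffunE.
have op0 s : opens 0 s = set0 by apply/setP => x; rewrite !inE.
case: h => [|h]; last first.
  by rewrite /wsum big_pred0 // => s; rewrite op0 cards0 andbF.
rewrite /wsum (bigD1 [ffun x => x]) /=; last by rewrite idI op0 cards0.
rewrite big1 => [|s /andP[/andP[/involP[_ sf] _] /eqP]]; last first.
  by case; apply/ffunP => x; rewrite ffunE sf.
rewrite addr0 (_ : weight _ = 0%N) //; apply/eqP; rewrite cards_eq0.
apply/eqP/setP => -[a c]; rewrite !inE !ffunE /=; apply/negP => /and3P[h1 h2 _].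
by rewrite ltnNge (ltnW h1) in h2.
Qed.

End Involutions.

(** * Weighted lattice paths *)

Section WeightedPaths.
Local Open Scope ring_scope.
Variables (K : comNzRingType) (q : K).

Local Arguments gauss : simpl never.

(** Paths of m unit steps from height 0 to height h through nonnegative heights, classified by the
    last step. *)
Fixpoint paths m h : nat :=
  (if m is m'.+1 then (if h is h'.+1 then paths m' h' else 0) + paths m' h.+1 else (h == 0))%N.

(** A down-step to height h has 1 - q times its weight in [wsum_rec], which keeps the solution below
    free of denominators. *)
Fixpoint qpaths m h : K :=
  if m is m'.+1 then
    (if h is h'.+1 then qpaths m' h' else 0) + (1 - q ^+ h.+1) * qpaths m' h.+1
  else (h == 0%N)%:R.

Lemma paths_small m h : (m < h)%N -> paths m h = 0%N.
Proof. by elim: m h => [|m IH] [|h] // mh; rewrite /= !IH //; lia. Qed.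

Lemma qpaths_small m h : (m < h)%N -> qpaths m h = 0.
Proof. by elim: m h => [|m IH] [|h] // mh; rewrite /= !IH ?mulr0 ?addr0 //; lia. Qed.

(** The weighted recursion is solved by superposing unweighted paths that end 2k higher. Terms with
    h + 2k > m vanish, hence the free bound M. *)
Lemma qpathsE m h M : (m < M)%N -> qpaths m h =
  \sum_(k < M) (paths m (h + k.*2)%N)%:R * ((-1) ^+ k * q ^+ tri k * gauss q (h + k)%N k).
Proof.
elim: m h M => [|m IH] h [|M] // mM.
  rewrite big_ord_recl big1 => [|k _]; last first.
    by rewrite /= (_ : (h + _ == 0)%N = false) ?mul0r // /bump; lia.
  by rewrite addr0 /= double0 !addn0 gauss0 (_ : tri 0 = 0%N) // !mulr1.
(* Comparison of the coefficients of [paths m (h.+1 + k.*2)] on the two sides of the recursion;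
   q-Pascal and [gauss_ratio] give it. *)
have key k : (-1) ^+ k.+1 * q ^+ tri k.+1 * gauss q (h + k).+1 k.+1 + (-1) ^+ k * q ^+ tri k * gauss q (h + k)%N k
   = (-1) ^+ k.+1 * q ^+ tri k.+1 * gauss q (h + k)%N k.+1
     + (1 - q ^+ h.+1) * ((-1) ^+ k * q ^+ tri k * gauss q (h.+1 + k)%N k).
  have e : (1 - q ^+ h.+1) * gauss q (h.+1 + k)%N k = (1 - q ^+ k.+1) * gauss q (h.+1 + k)%N k.+1.
    by rewrite gauss_ratio ?leq_addl // addSn -addSn addnK.
  have -> : (1 - q ^+ h.+1) * ((-1) ^+ k * q ^+ tri k * gauss q (h.+1 + k)%N k) =
     (-1) ^+ k * q ^+ tri k * ((1 - q ^+ h.+1) * gauss q (h.+1 + k)%N k) by ring.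
  rewrite e addSn gaussS triS exprD (exprS (-1)); ring.
pose A k : K := (-1) ^+ k * q ^+ tri k.
have small k : (M <= k)%N -> paths m (h.+1 + k.*2)%N = 0%N.
  by move=> Mk; apply: paths_small; rewrite -addnn; lia.
have down : qpaths m h.+1 = \sum_(k < M) (paths m (h.+1 + k.*2)%N)%:R * (A k * gauss q (h.+1 + k)%N k).
  by apply: IH.
have up : \sum_(k < M.+1) (paths m (h.+1 + k.*2)%N)%:R * (A k * gauss q (h + k)%N k) =
    \sum_(k < M) (paths m (h.+1 + k.*2)%N)%:R * (A k * gauss q (h + k)%N k).
  by rewrite big_ord_recr /= small // mul0r addr0.
have pS k : paths m.+1 (h + k.*2)%N =
    ((if (h + k.*2)%N is j.+1 then paths m j else 0) + paths m (h.+1 + k.*2)%N)%N by [].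
under eq_bigr => k _ do rewrite pS natrD mulrDl.
rewrite big_split /= up down mulr_sumr.
(* At height 0 there is no up-step to account for, and the corresponding term of [key] has the
   factor [gauss q k k.+1], which is 0. *)
case: h key small down up pS => [|h] key small _ _ _.
  rewrite add0r big_ord_recl /= mul0r add0r -big_split /=; apply: eq_bigr => k _.
  rewrite /bump leq0n !add0n !add1n [LHS]mulrCA -mulrDr; congr (_ * _); have := key k.
  by rewrite !add0n [gauss q k k.+1]gauss_small // mulr0 add0r => <-.
rewrite (IH h _ (ltnW mM)) big_ord_recl [in RHS]big_ord_recl -!addrA; congr (_ + _).
  by rewrite !addn0 !gauss0.
rewrite -!big_split /=; apply: eq_bigr => k _; rewrite /bump leq0n add1n.
rewrite addSn doubleS !addnS [X in _ + X = _]mulrCA -!mulrDr; congr (_ * _).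
by have := key k; rewrite !addSn => <-.
Qed.

End WeightedPaths.

(** Reflection principle, with t the number of up-steps. The additive form avoids truncated
    subtraction; Pascal's rule gives the induction step, together with the symmetry of an odd row
    when h = 0. *)
Lemma paths_bin m h t : m + h = t.*2 -> paths m h + 'C(m, t.+1) = 'C(m, t).
Proof.
elim: m h t => [|m IH] h t mh.
  by case: t mh => [|t]; rewrite add0n => ->; rewrite /= ?bin0n.
case: h mh => [|h] mh /=.
  case: t mh => [|t]; first by [].
  rewrite addn0 doubleS => -[mt]; have := IH 1 t.+1; rewrite addn1 mt doubleS => /(_ erefl).
  rewrite -mt !binS => h1; have <- : 'C(m, t.+1) = 'C(m, t).
    by rewrite -bin_sub mt -?addnn; [congr 'C(_, _)|]; lia.
  lia.
case: t mh => [|t]; first by rewrite addnS.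
rewrite addSn addnS doubleS => -[mh]; have := IH h t mh; have := IH h.+2 t.+1.
rewrite !addnS mh doubleS => /(_ erefl); rewrite !binS; lia.
Qed.

(** * The numerator of the Touchard-Riordan formula *)

Section TouchardRiordan.
Local Open Scope ring_scope.
Variables (K : comNzRingType) (q : K).

Lemma paths_ballot n j :
  (paths n.*2 j.*2)%:R = 'C(n.*2, n + j)%:R - 'C(n.*2, (n + j).+1)%:R :> K.
Proof.
by rewrite -(@paths_bin n.*2 j.*2 (n + j)) ?doubleD // natrD addrK.
Qed.

Lemma wsum_small N m h : (m <= N)%N -> (m < h)%N -> wsum q N m h = 0.
Proof.
elim: m h => [|m IH] [|h] // mN mh; first by rewrite wsum_init.
by rewrite wsum_rec // !IH ?mulr0 ?addr0 //; lia.
Qed.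

(** A path of h + 2t steps ending at height h has exactly t down-steps, each carrying a factor 1 -
    q. *)
Lemma qpaths_wsum N m h t : (m <= N)%N -> m = (h + t.*2)%N ->
  qpaths q m h = (1 - q) ^+ t * wsum q N m h.
Proof.
elim: m h t => [|m IH] h t mN mh.
  have [-> ->] : h = 0%N /\ t = 0%N by lia.
  by rewrite wsum_init expr0 mul1r.
have geo : 1 - q ^+ h.+1 = (1 - q) * \sum_(k < h.+1) q ^+ k.
  by rewrite -[1 - q]opprB mulNr -subrX1 opprB.
have mN' := ltnW mN.
rewrite wsum_rec //= geo mulrDr; congr (_ + _).
  by case: h mh {geo} => [|h] mh; [rewrite mulr0 | apply: IH => //; lia].
case: t mh => [|t] mh.
  by rewrite qpaths_small ?wsum_small ?mulr0 //; lia.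
by rewrite (IH h.+1 t) //; [rewrite exprS; ring | lia].
Qed.

(** At height 0 the Gaussian binomials of [qpathsE] are all 1 and the path numbers are ballot
    numbers; indices k > n contribute nothing. *)
Lemma wsum_touchard_riordan n : (1 - q) ^+ n * wsum q n.*2 n.*2 0 =
  \sum_(j < n.+1) (-1) ^+ j * q ^+ tri j * ('C(n.*2, n + j)%:R - 'C(n.*2, (n + j).+1)%:R).
Proof.
rewrite -qpaths_wsum // (@qpathsE _ _ _ _ n.*2.+1) //.
rewrite (bigID (fun k : 'I_n.*2.+1 => (k < n.+1)%N)) /= addrC big1 => [|k]; last first.
  by rewrite -leqNgt => nk; rewrite add0n paths_small ?mul0r // ltn_double.
have le : (n.+1 <= n.*2.+1)%N by rewrite ltnS -addnn leq_addr.
rewrite add0r (big_ord_widen _ (fun j => (-1) ^+ j * q ^+ tri j * ('C(n.*2, n + j)%:R - 'C(n.*2, (n + j).+1)%:R)) le).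
by apply: eq_bigr => k _; rewrite !add0n gauss_nn mulr1 paths_ballot mulrC.
Qed.

End TouchardRiordan.

(** * Pairings as fixed-point-free involutions *)

Section PairingsAsInvolutions.
Variable n : nat.
Local Notation I := 'I_(2 * n).
Implicit Types (s : {ffun I -> I}) (P : {set {set I}}).

Definition fpf_invol s := [forall x, s (s x) == x] && [forall x, s x != x].

Lemma fpf_involP s : reflect ((forall x, s (s x) = x) /\ (forall x, s x != x)) (fpf_invol s).
Proof.
apply: (iffP andP) => [[/forallP h1 /forallP h2]|[h1 h2]]; split=> //.
- by move=> x; apply/eqP.
- by apply/forallP => x; rewrite h1.
- exact/forallP.
Qed.

Definition blocks s : {set {set I}} := [set [set x; s x] | x in I].
(** On a pairing the default of [odflt] is never reached, as each point shares its block with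
    exactly one other point. *)
Definition partner P : {ffun I -> I} :=
  [ffun x => odflt x [pick y | (y != x) && ([set x; y] \in P)]].

Lemma mem_blocks s x y : fpf_invol s -> x != y -> ([set x; y] \in blocks s) = (y == s x).
Proof.
move=> /fpf_involP[ss sf] xy; apply/imsetP/eqP => [[z _ e]|->]; last by exists x.
have : x \in [set z; s z] by rewrite -e !inE eqxx.
have : y \in [set z; s z] by rewrite -e !inE eqxx orbT.
by rewrite !inE => /orP[]/eqP yz /orP[]/eqP xz; move: xy; rewrite yz xz ?eqxx ?ss.
Qed.

Lemma blocks_pairing s : fpf_invol s -> is_pairing (blocks s).
Proof.
move=> sF; have [ss sf] := fpf_involP _ sF.
apply/andP; split; last first.
  by apply/forall_inP => B /imsetP[x _ ->]; rewrite cards2 [x == _]eq_sym sf.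
apply/and3P; split.
- apply/eqP/setP => x; rewrite [RHS]inE; apply/bigcupP.
  by exists [set x; s x]; [exact: imset_f | rewrite !inE eqxx].
- apply/trivIsetP => A B /imsetP[x _ ->] /imsetP[y _ ->] AB.
  rewrite disjoints_subset; apply/subsetP => z; rewrite !inE => zx.
  apply: contraNN AB => zy; apply/eqP.
  have blockz w : (z == w) || (z == s w) -> [set w; s w] = [set z; s z].
    by move=> /orP[]/eqP-> //; rewrite ss setUC.
  by rewrite (blockz x) // (blockz y).
- by apply/imsetP => -[x _] /setP/(_ x); rewrite !inE eqxx.
Qed.

Lemma pairing_partner P : is_pairing P ->
  fpf_invol (partner P) /\ blocks (partner P) = P.
Proof.
move=> /andP[partP /forall_inP card2].
have [/eqP cov triv no0] := and3P partP.
have ex x : exists y, (y != x) && ([set x; y] \in P).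
  have : x \in cover P by rewrite cov inE.
  move=> /bigcupP[B BP xB]; have /cards2P[a [b [ab eB]]] := card2 B BP.
  move: xB; rewrite eB !inE => /orP[]/eqP->.
    by exists b; rewrite eq_sym ab -eB.
  by exists a; rewrite ab setUC -eB.
have uniqP x y z : [set x; y] \in P -> [set x; z] \in P -> y != x -> z != x -> y = z.
  move=> yP zP yx zx.
  have xy : x \in [set x; y] by rewrite !inE eqxx.
  have xz : x \in [set x; z] by rewrite !inE eqxx.
  have := def_pblock triv yP xy; rewrite (def_pblock triv zP xz) => /setP/(_ y).
  by rewrite !inE eqxx orbT (negPf yx) /= => /eqP.
have pP x : (partner P x != x) && ([set x; partner P x] \in P).
  by rewrite ffunE; case: pickP => [y //|no] /=; have [y] := ex x; rewrite no.
have F : fpf_invol (partner P).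
  apply/fpf_involP; split=> x; last by case/andP: (pP x).
  have /andP[h1 h2] := pP x; have /andP[h3 h4] := pP (partner P x).
  by apply: (uniqP (partner P x)); rewrite // ?[[set _; x]]setUC // eq_sym.
split=> //; apply/setP => B; apply/imsetP/idP => [[x _ ->]|BP].
  by case/andP: (pP x).
have /cards2P[a [b [ab eB]]] := card2 B BP; exists a => //; rewrite eB.
have /andP[h1 h2] := pP a.
by rewrite (@uniqP a b (partner P a)) // -?eB // eq_sym.
Qed.

Lemma partner_blocks s : fpf_invol s -> partner (blocks s) = s.
Proof.
move=> sF; have [ss sf] := fpf_involP _ sF.
have [/fpf_involP[pp pf] e] := pairing_partner (blocks_pairing sF).
apply/ffunP => x; apply/eqP; rewrite -mem_blocks //; last by rewrite eq_sym pf.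
have : [set x; partner (blocks s) x] \in blocks (partner (blocks s)) by apply: imset_f.
by rewrite e.
Qed.

(** Listing two crossing blocks by their left endpoints a < c turns the unordered pairs of [cr] into
    the ordered pairs of [crossings]; without fixed points the clause about open points is void. *)
Lemma cr_blocks s : fpf_invol s -> cr (blocks s) = weight s.
Proof.
move=> sF; have [ss sf] := fpf_involP _ sF.
pose pr (p : I * I) : {set {set I}} := [set [set p.1; s p.1]; [set p.2; s p.2]].
have crossE p : (p \in crossings s) = [&& p.1 < p.2, p.2 < s p.1 & s p.1 < s p.2].
  by rewrite inE (negPf (sf _)) orbF.
have minE (a b : I) : a < s a -> b < s b -> [set a; s a] = [set b; s b] -> a = b.
  move=> ha hb /setP/(_ a); rewrite !inE eqxx /= => /esym/orP[/eqP//|/eqP e].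
  by move: ha hb; rewrite e ss => h1 h2; have := ltn_trans h1 h2; rewrite ltnn.
rewrite /cr /weight -(@card_in_imset _ _ pr); last first.
  move=> [a c] [b d]; rewrite !crossE /= => /and3P[ac ca acs] /and3P[bd db bds] e.
  have ha := ltn_trans ac ca; have hc := ltn_trans ca acs.
  have hb := ltn_trans bd db; have hd := ltn_trans db bds.
  have : [set a; s a] \in pr (b, d) by rewrite -e !inE eqxx.
  have : [set c; s c] \in pr (b, d) by rewrite -e !inE eqxx orbT.
  have irr (x y : I) : x < y -> y < x -> False.
    by move=> h1 h2; have := ltn_trans h1 h2; rewrite ltnn.
  rewrite !inE /= => /orP[]/eqP/minE hc' /orP[]/eqP/minE ha'.
  - by move: ac; rewrite hc' // ha' // ltnn.
  - by case: (irr a c ac); rewrite hc' // ha'.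
  - by rewrite hc' // ha'.
  - by move: ac; rewrite hc' // ha' // ltnn.
congr #|pred_of_set _|; apply/setP => S; rewrite inE; apply/and3P/imsetP.
  move=> [sub _ /existsP[B /existsP[C /andP[/eqP SE]]]].
  move=> /existsP[a /existsP[b /existsP[c /existsP[d /and5P[/eqP BE /eqP CE ab cd cross]]]]].
  have : B \in blocks s by apply: (subsetP sub); rewrite SE !inE eqxx.
  have : C \in blocks s by apply: (subsetP sub); rewrite SE !inE eqxx orbT.
  rewrite BE CE !mem_blocks ?neq_ltn ?ab ?cd // => /eqP dE /eqP bE.
  rewrite {}SE {}BE {}CE {}dE {}bE in ab cd cross *.
  case/orP: cross => /andP[/andP[h1 h2] h3].
    by exists (a, c); rewrite // crossE /= h1 h2.
  by exists (c, a); rewrite ?crossE /= ?h1 ?h2 // /pr /= setUC.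
move=> [[a c]]; rewrite crossE /= => /and3P[ac ca acs] ->.
have hne : [set a; s a] != [set c; s c].
  have ha := ltn_trans ac ca; have hc := ltn_trans ca acs.
  by apply/eqP => /minE h; move: ac; rewrite h // ltnn.
split.
- by apply/subsetP => B; rewrite !inE => /orP[]/eqP->; apply: imset_f.
- by rewrite cards2 hne.
- apply/existsP; exists [set a; s a]; apply/existsP; exists [set c; s c]; rewrite eqxx /=.
  apply/existsP; exists a; apply/existsP; exists (s a); apply/existsP; exists c.
  apply/existsP; exists (s c); rewrite !eqxx (ltn_trans ac ca) (ltn_trans ca acs) /=.
  by rewrite ac ca acs.
Qed.

Lemma sum_pairings (K : comNzRingType) (q : K) :
  (\sum_(P : {set {set I}} | is_pairing P) q ^+ cr P = wsum q (2 * n) (2 * n) 0)%R.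
Proof.
rewrite (reindex_onto blocks partner) => [|P /pairing_partner[]//].
apply: eq_big => [s|s /andP[pS /eqP e]]; last first.
  by have [F _] := pairing_partner pS; rewrite e in F; rewrite cr_blocks.
have -> : invol (2 * n) s && (#|opens (2 * n) s| == 0%N) = fpf_invol s.
  apply/andP/fpf_involP => [[/involP[ss _] /eqP/cards0_eq o0]|[ss sf]]; split=> //.
  - by move=> x; have /setP/(_ x) := o0; rewrite !inE ltn_ord /= => /negbT.
  - by apply/involP; split=> // x; rewrite leqNgt ltn_ord.
  - rewrite cards_eq0; apply/eqP/setP => x; rewrite !inE (negPf (sf _)) andbF //.
apply/andP/idP => [[pS /eqP <-]|sF]; first by have [] := pairing_partner pS.
by rewrite partner_blocks // blocks_pairing.
Qed.

End PairingsAsInvolutions.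

From mathcomp Require Import complex boolp classical_sets reals filter topology normedtype sequences exp.
Import numFieldNormedType.Exports.

(** * Formal power series as coefficient sequences *)

Section FormalSeries.
Local Open Scope ring_scope.
Variable K : comNzRingType.
Implicit Types a b c P : nat -> K.

Definition conv a b (k : nat) : K := \sum_(i < k.+1) a i * b (k - i)%N.
Definition fone (k : nat) : K := (k == 0)%:R.
Definition der a (k : nat) : K := k.+1%:R * a k.+1.
Definition trunc a N : {poly K} := \poly_(i < N) a i.

Lemma coef_trunc a N k : (k < N)%N -> (trunc a N)`_k = a k.
Proof. by move=> h; rewrite coef_poly h. Qed.

(** Since a coefficient of a product involves no higher ones, the ring laws of series come from
    those of polynomials. *)
Lemma conv_trunc a b k N : (k < N)%N ->
  conv a b k = (trunc a N * trunc b N)`_k.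
Proof.
move=> kN; rewrite coefM; apply: eq_bigr => i _.
by rewrite !coef_trunc //; move: (ltn_ord i); lia.
Qed.

Lemma coefM_eq (p p' q q' : {poly K}) k :
  (forall i, (i <= k)%N -> p`_i = p'`_i) -> (forall i, (i <= k)%N -> q`_i = q'`_i) ->
  (p * q)`_k = (p' * q')`_k.
Proof.
move=> hp hq; rewrite !coefM; apply: eq_bigr => i _.
by rewrite hp ?hq //; move: (ltn_ord i); lia.
Qed.

Lemma convC a b : conv a b = conv b a.
Proof. by apply/funext => k; rewrite !(@conv_trunc _ _ k k.+1) // mulrC. Qed.

Lemma convA a b c : conv a (conv b c) = conv (conv a b) c.
Proof.
apply/funext => k; rewrite !(@conv_trunc _ _ k k.+1) //.
rewrite -[RHS](@coefM_eq (trunc a k.+1 * trunc b k.+1) _ (trunc c k.+1)) //.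
  rewrite -mulrA; apply: coefM_eq => // i ik.
  by rewrite coef_trunc ?ltnS // (@conv_trunc _ _ i k.+1).
by move=> i ik; rewrite coef_trunc ?ltnS // (@conv_trunc _ _ i k.+1).
Qed.

Lemma convDl a b c : conv (a \+ b) c = conv a c \+ conv b c.
Proof.
by apply/funext => k; rewrite /conv /= -big_split; apply: eq_bigr => i _; rewrite mulrDl.
Qed.

Lemma convDr a b c : conv c (a \+ b) = conv c a \+ conv c b.
Proof. by rewrite ![conv c _]convC convDl. Qed.

Lemma conv1l a : conv fone a = a.
Proof.
apply/funext => k; rewrite /conv big_ord_recl /= /fone eqxx mul1r subn0.
by rewrite big1 ?addr0 // => i _; rewrite mul0r.
Qed.

Lemma conv1r a : conv a fone = a. Proof. by rewrite convC conv1l. Qed.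

Lemma conv_at0 a b : conv a b 0%N = a 0%N * b 0%N.
Proof. by rewrite /conv big_ord1. Qed.

Lemma der_conv a b : der (conv a b) = conv (der a) b \+ conv a (der b).
Proof.
have coef_der c k N : (k.+1 < N)%N -> (trunc c N)^`()`_k = der c k.
  by move=> h; rewrite coef_deriv coef_trunc // /der mulr_natl.
apply/funext => k /=.
rewrite /der (@conv_trunc _ _ k.+1 k.+2) // mulr_natl -coef_deriv derivM coefD.
by congr (_ + _); rewrite (@conv_trunc _ _ k k.+2) //; apply: coefM_eq => i ik;
  rewrite ?coef_der ?coef_trunc // ltnS leqW.
Qed.

Lemma der_one : der fone = (fun=> 0).
Proof. by apply/funext => k; rewrite /der /fone mulr0. Qed.

(** Course-of-values recursion; the hypothesis says that [F k u] uses only u 0, ..., u k. *)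
Lemma strong_rec (T : Type) (x0 : T) (F : nat -> (nat -> T) -> T) :
  (forall k u v, (forall i, (i <= k)%N -> u i = v i) -> F k u = F k v) ->
  exists u : nat -> T, u 0%N = x0 /\ forall k, u k.+1 = F k u.
Proof.
move=> Fext.
(* [U n] is correct at the indices up to n, so the diagonal [U k k] is the sequence sought. *)
pose U := fix U n : nat -> T := if n is m.+1 then
  (fun i => if i == 0%N then x0 else F i.-1 (U m)) else (fun=> x0).
have stab n m i : (i <= n)%N -> (i <= m)%N -> U n i = U m i.
  elim: n m i => [|n IH] [|m] [|i] //= hn hm.
  by apply: Fext => j hj; apply: IH; lia.
exists (fun k => U k k); split=> // k /=.
by apply: Fext => i ik; apply: stab.
Qed.

Lemma conv_inv_ex a : a 0%N = 1 -> exists x, conv a x = fone.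
Proof.
move=> a0.
have [|x [x0 xS]] := @strong_rec K 1 (fun k u => - \sum_(i < k.+1) a i.+1 * u (k - i)%N).
  by move=> k u v uv; congr (- _); apply: eq_bigr => i _; rewrite uv // leq_subr.
exists x; apply/funext => -[|k]; rewrite /conv big_ord_recl a0 mul1r subn0.
  by rewrite big_ord0 addr0 x0.
by rewrite xS addNr.
Qed.

Lemma conv_cancel a b c : a 0%N = 1 -> conv b a = conv c a -> b = c.
Proof.
move=> /conv_inv_ex[x ax] bc.
by rewrite -[b]conv1r -[c]conv1r -ax !convA bc.
Qed.

End FormalSeries.

Arguments fone {K}.
Arguments der {K}.

(** * Formal exponentials and logarithmic derivatives *)

Section FormalExp.
Local Open Scope ring_scope.
Variable K : numFieldType.
Implicit Types a b P Q : nat -> K.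

(** The equation a' = P a expresses (k + 1) a_(k + 1) through earlier coefficients, and k + 1 is
    invertible in characteristic 0. *)
Lemma der_conv_uniq P a b : a 0%N = b 0%N -> der a = conv P a -> der b = conv P b -> a = b.
Proof.
move=> ab0 da db; apply/funext => k.
elim/ltn_ind: k => -[//|k] IH.
have nz : k.+1%:R != 0 :> K by rewrite pnatr_eq0.
apply: (mulfI nz); change (der a k = der b k).
by rewrite da db; apply: eq_bigr => i _; rewrite IH // ltnS leq_subr.
Qed.

Lemma fexp_ex P : exists a, a 0%N = 1 /\ der a = conv P a.
Proof.
have [|a [a0 aS]] :=
    @strong_rec K 1 (fun k u => k.+1%:R^-1 * \sum_(i < k.+1) P i * u (k - i)%N).
  by move=> k u v uv; congr (_ * _); apply: eq_bigr => i _; rewrite uv // leq_subr.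
exists a; split=> //; apply/funext => k.
by rewrite /der aS mulrA mulfV ?mul1r // pnatr_eq0.
Qed.

(* The formal series exp (\sum_(k >= 0) P k / (k + 1) * X^(k + 1)). *)
Definition fexp P : nat -> K := sval (cid (fexp_ex P)).

Lemma fexp0 P : fexp P 0%N = 1.
Proof. by rewrite /fexp; case: cid => a [/=]. Qed.

Lemma der_fexp P : der (fexp P) = conv P (fexp P).
Proof. by rewrite /fexp; case: cid => a [/=]. Qed.

Lemma fexp_uniq P a : a 0%N = 1 -> der a = conv P a -> a = fexp P.
Proof. by move=> a0 da; apply: der_conv_uniq (da) (der_fexp P); rewrite fexp0. Qed.

Lemma fexpD P Q : fexp (P \+ Q) = conv (fexp P) (fexp Q).
Proof.
symmetry; apply: fexp_uniq; first by rewrite conv_at0 !fexp0 mulr1.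
rewrite der_conv !der_fexp convDl; congr (_ \+ _); first by rewrite convA.
by rewrite convA [conv (fexp P) Q]convC -convA.
Qed.

Lemma fexp_zero : fexp (fun=> 0) = fone.
Proof.
symmetry; apply: fexp_uniq => //; rewrite der_one; apply/funext => k.
by rewrite /conv big1 // => i _; rewrite mul0r.
Qed.

Lemma fexp_natmul n P : fexp (fun k => n%:R * P k) = iter n (conv (fexp P)) fone.
Proof.
elim: n => [|n IH] /=.
  by rewrite -fexp_zero; congr fexp; apply/funext => k; rewrite mul0r.
rewrite -IH -fexpD; congr fexp; apply/funext => k /=.
by rewrite mulrS mulrDl mul1r.
Qed.

Lemma fexpN P : conv (fexp P) (fexp (fun k => - P k)) = fone.
Proof.
by rewrite -fexpD -fexp_zero; congr fexp; apply/funext => k /=; rewrite subrr.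
Qed.

(** The series 1 / (1 - q) is its own logarithmic derivative. *)
Lemma fexp_one : fexp (fun=> 1) = (fun=> 1).
Proof.
symmetry; apply: fexp_uniq => //; apply/funext => k.
rewrite /der mulr1 /conv (eq_bigr (fun=> 1)) => [|i _]; last by rewrite mulr1.
by rewrite sumr_const card_ord.
Qed.

Lemma fexp_oneN : fexp (fun=> - 1) = (fun k => (k == 0%N)%:R - (k == 1%N)%:R).
Proof.
symmetry; apply: fexp_uniq; first by rewrite subr0.
apply/funext => k; rewrite /der /conv sub0r eqSS.
under eq_bigr do rewrite mulN1r.
rewrite sumrN sumrB big_ord_recr /= subnn eqxx big1 ?add0r => [|i _]; last first.
  by rewrite subn_eq0 leqNgt ltn_ord.
rewrite mulrN; congr (- _).
case: k => [|k]; first by rewrite big_ord1 subr0 mulr1.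
rewrite mulr0 !big_ord_recr /= subnn big1 => [|i _]; last first.
  by rewrite (_ : (k.+1 - i == 1)%N = false) //; have := ltn_ord i; lia.
by rewrite -[k.+1]addn1 addKn eqxx add0r addr0 subrr.
Qed.

End FormalExp.

(** * Weighted l^1 norms *)

Section WeightedNorm.
Local Open Scope ring_scope.
Variable R : realFieldType.
Implicit Types (a b P Q : nat -> R) (r B : R).

(** Bounding all partial sums amounts to bounding the norm and presupposes no convergence. *)
Definition l1_le a r B := forall N, \sum_(k < N) `|a k| * r ^+ k <= B.

Lemma l1_le_ge0 a r B : l1_le a r B -> 0 <= B.
Proof. by move/(_ 0%N); rewrite big_ord0. Qed.

Lemma l1_le_coef a r B k : 0 <= r -> l1_le a r B -> `|a k| * r ^+ k <= B.
Proof.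
move=> r0 /(_ k.+1); apply: le_trans.
rewrite big_ord_recr /= lerDr; apply: sumr_ge0 => i _.
by rewrite mulr_ge0 ?exprn_ge0.
Qed.

Lemma l1_le_mono a b r B : 0 <= r -> (forall k, `|a k| <= `|b k|) -> l1_le b r B -> l1_le a r B.
Proof.
move=> r0 ab h N; apply: le_trans (h N); apply: ler_sum => i _.
by rewrite ler_wpM2r ?exprn_ge0.
Qed.

Lemma l1_leW a r B B' : B <= B' -> l1_le a r B -> l1_le a r B'.
Proof. by move=> BB h N; apply: le_trans (h N) BB. Qed.

Lemma sum_triangle (V : zmodType) (F : nat -> nat -> V) N :
  \sum_(k < N) \sum_(i < k.+1) F i (k - i)%N = \sum_(i < N) \sum_(j < N - i) F i j.
Proof.
elim: N => [|N IH]; first by rewrite !big_ord0.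
rewrite big_ord_recr [in RHS]big_ord_recr /= subSnn big_ord1 IH.
rewrite big_ord_recr /= subnn addrA; congr (_ + _).
rewrite -big_split; apply: eq_bigr => i _ /=.
by rewrite subSn ?(ltnW (ltn_ord i)) // big_ord_recr.
Qed.

(** Measures by how much a product of partial sums exceeds the partial sum of the Cauchy product. *)
Lemma sum_square_triangle (V : zmodType) (F : nat -> nat -> V) N :
  \sum_(i < N) \sum_(j < N) F i j - \sum_(k < N) \sum_(i < k.+1) F i (k - i)%N
  = \sum_(i < N) \sum_(j < N | (N <= i + j)%N) F i j.
Proof.
rewrite sum_triangle -sumrB; apply: eq_bigr => i _.
rewrite (bigID (fun j : 'I_N => (N <= i + j)%N)) /= addrAC -[RHS]addr0 -addrA; congr (_ + _).
apply/eqP; rewrite addrC subr_eq0; apply/eqP.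
rewrite (big_ord_widen N (F i)) ?leq_subr //; apply: eq_bigl => j.
by have := ltn_ord i; lia.
Qed.

Lemma psum_conv_le a b r N : 0 <= r ->
  \sum_(k < N) `|conv a b k| * r ^+ k <=
  (\sum_(k < N) `|a k| * r ^+ k) * (\sum_(k < N) `|b k| * r ^+ k).
Proof.
move=> r0.
pose F i j := (`|a i| * r ^+ i) * (`|b j| * r ^+ j).
have F0 i j : 0 <= F i j by rewrite !mulr_ge0 ?exprn_ge0.
apply: (@le_trans _ _ (\sum_(k < N) \sum_(i < k.+1) F i (k - i)%N)).
  apply: ler_sum => k _.
  apply: le_trans (ler_wpM2r (exprn_ge0 k r0) (ler_norm_sum _ _ _)) _.
  rewrite mulr_suml; apply: ler_sum => i _.
  by rewrite normrM /F mulrACA -exprD subnKC // -ltnS.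
rewrite big_distrlr /= -subr_ge0 sum_square_triangle.
by apply: sumr_ge0 => i _; apply: sumr_ge0 => j _.
Qed.

Lemma l1_le_conv a b r A B : 0 <= r -> l1_le a r A -> l1_le b r B -> l1_le (conv a b) r (A * B).
Proof.
move=> r0 ha hb N; apply: le_trans (psum_conv_le _ _ _ r0) _.
by apply: ler_pM (ha N) (hb N); apply: sumr_ge0 => i _; rewrite mulr_ge0 ?exprn_ge0.
Qed.

(** A partial sum S for y satisfies S <= A + t S, which can be solved for S because t < 1. *)
Lemma neumann a d y r A t : 0 <= r -> t < 1 -> l1_le a r A -> l1_le d r t ->
  y = a \+ conv d y -> l1_le y r (A / (1 - t)).
Proof.
move=> r0 t1 ha hd yE N; set S := \sum_(k < N) _.
rewrite ler_pdivlMr ?subr_gt0 // mulrBr mulr1 lerBlDr.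
have S0 : 0 <= S by apply: sumr_ge0 => i _; rewrite mulr_ge0 ?exprn_ge0.
apply: (@le_trans _ _ (\sum_(k < N) `|a k| * r ^+ k + \sum_(k < N) `|conv d y k| * r ^+ k)).
  rewrite -big_split /=; apply: ler_sum => k _; rewrite -mulrDl ler_wpM2r ?exprn_ge0 //.
  by rewrite {1}yE ler_normD.
apply: lerD (ha N) _; apply: le_trans (psum_conv_le _ _ _ r0) _.
by rewrite mulrC ler_wpM2l // hd.
Qed.

Lemma l1_le_one r : l1_le (fone : nat -> R) r 1.
Proof.
move=> [|N]; first by rewrite big_ord0 ler01.
rewrite big_ord_recl big1 ?addr0 ?expr0 ?normr1 ?mulr1 // => i _.
by rewrite normr0 mul0r.
Qed.

Lemma l1_le_iter_conv a n r B : 0 <= r -> l1_le a r B -> l1_le (iter n (conv a) fone) r (B ^+ n).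
Proof.
move=> r0 ha; elim: n => [|n IH]; first exact: l1_le_one.
by rewrite exprS; apply: l1_le_conv.
Qed.

Lemma sum_geom_le r N : 0 <= r -> r < 1 -> \sum_(k < N) r ^+ k <= (1 - r)^-1.
Proof.
move=> r0 r1; have r1' : 0 < 1 - r by rewrite subr_gt0.
rewrite -(ler_pM2l r1') mulfV ?gt_eqF //.
by rewrite -[1 - r]opprB mulNr -subrX1 opprB gerBl exprn_ge0.
Qed.

Lemma l1_le_geom r : 0 <= r -> r < 1 -> l1_le (fun=> 1) r (1 - r)^-1.
Proof.
move=> r0 r1 N; under eq_bigr do rewrite normr1 mul1r.
exact: sum_geom_le.
Qed.

(** The coefficients of [fexp P] are polynomials in those of P with nonnegative coefficients, so
    majorants pass from P to [fexp P]. *)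
Lemma norm_fexp_le P Q k : (forall j, `|P j| <= Q j) -> `|fexp P k| <= fexp Q k.
Proof.
move=> PQ; elim/ltn_ind: k => -[|k] IH; first by rewrite !fexp0 normr1.
have kp : 0 < k.+1%:R :> R by rewrite ltr0n.
rewrite -(ler_pM2l kp) -[X in X * `|_|]ger0_norm ?ler0n // -normrM.
rewrite -[k.+1%:R * fexp P _]/(der _ _) -[k.+1%:R * fexp Q _]/(der _ _) !der_fexp /conv.
apply: le_trans (ler_norm_sum _ _ _) _; apply: ler_sum => i _; rewrite normrM.
by apply: ler_pM => //; apply: IH; rewrite ltnS leq_subr.
Qed.

(** The constant majorant m leads to the series (1 - q)^(-m). *)
Lemma l1_le_fexp P m r : 0 <= r -> r < 1 -> (forall j, `|P j| <= m%:R) ->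
  l1_le (fexp P) r ((1 - r)^-1 ^+ m).
Proof.
move=> r0 r1 Pm.
apply: (@l1_le_mono _ (fexp (fun=> m%:R * 1))) => //.
  move=> k; apply: le_trans _ (ler_norm _).
  by apply: norm_fexp_le => j; rewrite mulr1.
by rewrite fexp_natmul fexp_one; apply: l1_le_iter_conv => //; apply: l1_le_geom.
Qed.

(** Inductively (k + 1) a_(k + 1) is a sum of k + 1 products, each at most s r^(k + 1); [s <= 1] is
    what absorbs the factor s of an earlier coefficient. *)
Lemma norm_fexp_small P s r k : 0 <= s -> s <= 1 -> 0 <= r ->
  (forall j, `|P j| <= s * r ^+ j.+1) -> `|fexp P k.+1| <= s * r ^+ k.+1.
Proof.
move=> s0 s1 r0 hP; elim/ltn_ind: k => k IH.
have kp : 0 < k.+1%:R :> R by rewrite ltr0n.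
rewrite -(ler_pM2l kp) -[X in X * `|_|]ger0_norm ?ler0n // -normrM.
rewrite -[k.+1%:R * fexp P _]/(der _ _) !der_fexp /conv.
apply: le_trans (ler_norm_sum _ _ _) _.
rewrite mulr_natl -[X in _ <= _ *+ X]card_ord -sumr_const; apply: ler_sum => i _.
rewrite normrM; have -> : s * r ^+ k.+1 = (s * r ^+ i.+1) * r ^+ (k - i)%N.
  by rewrite -mulrA -exprD; congr (_ * _ ^+ _); have := ltn_ord i; lia.
apply: ler_pM => //.
case E : (k - i)%N => [|l]; first by rewrite fexp0 normr1.
apply: le_trans (IH l _) _; first by have := ltn_ord i; lia.
by rewrite ler_piMl // exprn_ge0.
Qed.

End WeightedNorm.

(** * Inverses of the finite products, bounded uniformly *)

Section Convergence.
Local Open Scope ring_scope.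
Variable R : realType.
Implicit Types (a b : nat -> R) (r : R).

Lemma conv_agree (K : comNzRingType) (a a' b : nat -> K) N :
  (forall k, (k < N)%N -> a k = a' k) -> forall k, (k < N)%N -> conv a b k = conv a' b k.
Proof.
by move=> h k kN; apply: eq_bigr => i _; rewrite h //; have := ltn_ord i; lia.
Qed.

Lemma conv_inv_agree (K : comNzRingType) (a b x y : nat -> K) N :
  (forall k, (k < N)%N -> a k = b k) -> conv a x = fone -> conv b y = fone ->
  forall k, (k < N)%N -> x k = y k.
Proof.
move=> ab ax byy k kN.
rewrite -[x]conv1l -byy -convA -(conv_agree _ ab kN).
by rewrite convA [conv a y]convC -convA ax conv1r.
Qed.

(** The factor 1 - q^i has an inverse of norm at most 1 / (1 - r^i) <= exp (r^i / (1 - r^i)) <= exp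
    (r^(i - 1) / (1 - r)), and the exponents sum to at most (1 - r)^(-2) whatever m is. *)
Lemma qpoch_inv_bound r : 0 <= r -> r < 1 -> exists A, forall m,
  exists2 z, conv (fun k => (qpoch ('X : {poly R}) m)`_k) z = fone & l1_le z r A.
Proof.
move=> r0 r1; have r1' : 0 < 1 - r by rewrite subr_gt0.
exists (expR ((1 - r)^-1 * (1 - r)^-1)) => m.
suff [z zE hz] : exists2 z, conv (fun k => (qpoch ('X : {poly R}) m)`_k) z = fone
    & l1_le z r (expR ((1 - r)^-1 * \sum_(i < m) r ^+ i)).
  exists z => //; apply: l1_leW hz; rewrite ler_expR ler_wpM2l ?invr_ge0 ?(ltW r1') //.
  exact: sum_geom_le.
elim: m => [|m [z zE hz]].
  exists fone; first by rewrite conv1r; apply/funext => k; rewrite /qpoch big_ord0 coef1.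
  by rewrite big_ord0 mulr0 expR0; apply: l1_le_one.
pose d k : R := (k == m.+1)%:R.
have [|y yE] := @conv_inv_ex R (fun k => fone k - d k); first by rewrite /fone /d subr0.
have yE' : y = fone \+ conv d y.
  rewrite -{1}[y]conv1l; have {1}-> : fone = (fun k => fone k - d k) \+ d :> (nat -> R).
    by apply/funext => k /=; rewrite subrK.
  by rewrite convDl yE.
have rm1 : r ^+ m.+1 <= r by rewrite exprS ler_piMr // exprn_ile1 // ltW.
have hd : l1_le d r (r ^+ m.+1).
  move=> N; have [mN|Nm] := ltnP m.+1 N.
    rewrite (bigD1 (Ordinal mN)) //= /d eqxx normr1 mul1r big1 ?addr0 // => i /negPf ni.
    by have -> : (i == m.+1 :> nat) = false by []; rewrite normr0 mul0r.
  rewrite big1 ?exprn_ge0 // => i _; rewrite /d.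
  by rewrite ltn_eqF ?(leq_trans (ltn_ord i)) // normr0 mul0r.
exists (conv z y).
  have -> : (fun k => (qpoch ('X : {poly R}) m.+1)`_k)
      = conv (fun k => (qpoch ('X : {poly R}) m)`_k) (fun k => fone k - d k).
    apply/funext => k; rewrite /qpoch big_ord_recr coefM; apply: eq_bigr => i _.
    by rewrite coefB coef1 coefXn.
  by rewrite -convA [conv _ (conv z y)]convA [conv _ z]convC -convA yE conv1r.
rewrite big_ord_recr /= mulrDr expRD.
apply: l1_leW (l1_le_conv r0 hz (neumann r0 _ (@l1_le_one _ r) hd yE')); last first.
  by apply: le_lt_trans rm1 r1.
rewrite ler_wpM2l ?expR_ge0 // div1r.
have rm : r ^+ m.+1 < 1 by apply: le_lt_trans rm1 r1.
have rm' : 0 < 1 - r ^+ m.+1 by rewrite subr_gt0.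
apply: le_trans (_ : expR (r ^+ m.+1 / (1 - r ^+ m.+1)) <= _).
  apply: le_trans (expR_ge1Dx _).
  by rewrite -{2}(mulfV (lt0r_neq0 rm')) -mulrDl subrK mul1r.
rewrite ler_expR mulrC ler_pM ?invr_ge0 ?exprn_ge0 ?(ltW rm') //.
  by rewrite lef_pV2 ?posrE // lerB.
by rewrite exprS ler_piMl ?exprn_ge0 // ltW.
Qed.

End Convergence.

(** * Ballot numbers and the normalised numerators *)

Section Ballot.
Local Open Scope ring_scope.
Variable R : realType.
Implicit Types (c : nat -> R) (r : R).

(* Coefficients of [\sum_j (-1)^j * c j * q^(j (j + 1) / 2)]. *)
Definition tricoef c (k : nat) : R := \sum_(j < k.+1 | tri j == k) (-1) ^+ j * c j.

Lemma tricoef_widen c k N : (k < N)%N ->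
  tricoef c k = \sum_(j < N | tri j == k) (-1) ^+ j * c j.
Proof.
move=> kN; rewrite /tricoef (big_ord_widen_cond N (fun j => tri j == k)
  (fun j => (-1) ^+ j * c j)) //.
by apply: eq_bigl => j; case: eqP => //= <-; rewrite ltnS leq_tri.
Qed.

(** As [tri] is injective, at most one index contributes. The quantifier over [c] stands inside the
    alternatives so that two sequences can be compared at the same k. *)
Variant tricoef_spec k : Type :=
| TriCoef j of k = tri j & (forall c, tricoef c k = (-1) ^+ j * c j)
| TriCoef0 of (forall c, tricoef c k = 0).

Lemma tricoefP k : tricoef_spec k.
Proof.
have [/existsP/sigW[j /eqP jk]|no] := boolP [exists j : 'I_k.+1, tri j == k].
  apply: (@TriCoef _ j) => [//|c]; rewrite /tricoef (bigD1 j) ?jk //= big1 ?addr0 //.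
  move=> i /andP[/eqP ik /eqP ij]; case: ij; apply: val_inj; apply: tri_inj.
  by rewrite ik jk.
apply: TriCoef0 => c; rewrite /tricoef big1 // => j jk.
by case/existsP: no; exists j.
Qed.

Lemma tricoef0 c : tricoef c 0%N = c 0%N.
Proof. by rewrite /tricoef big_mkcond big_ord1 /= mul1r. Qed.

Definition ballot n j : R := 'C(n.*2, n + j)%:R - 'C(n.*2, (n + j).+1)%:R.

Lemma ballot_bin n j : (n + j).+1%:R * ballot n j = j.*2.+1%:R * 'C(n.*2, n + j)%:R.
Proof.
rewrite /ballot mulrBr -[_ * 'C(_, _.+1)%:R]natrM.
have [nj|nj] := leqP (n + j) n.*2; last first.
  by rewrite !bin_small ?mulr0 ?muln0 ?subr0 //; lia.
rewrite mul_bin_left natrM natrB // -mulrBl; congr (_ * _).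
by rewrite -!addnn !mulrS !natrD; ring.
Qed.

Lemma ballot_small n j : (n < j)%N -> ballot n j = 0.
Proof. by move=> nj; rewrite /ballot !bin_small ?subrr //; lia. Qed.

(** Normalised at j = 0, so that the numerator gets constant term 1 and has a formal inverse. *)
Definition rballot n j : R := ballot n j / ballot n 0.

Lemma ballot0_gt0 n : 0 < ballot n 0.
Proof.
have := ballot_bin n 0; rewrite mul1r addn0 => h.
have : 0 < n.+1%:R * ballot n 0 by rewrite h ltr0n bin_gt0 -addnn leq_addr.
by rewrite pmulr_rgt0 // ltr0n.
Qed.

(* [n (n+1) - j (j+1) = (n - j) (n + j + 1)] turns the recursion in [n] into a first order
   differential operator in [q], as [tri j = j (j+1) / 2]. *)
Lemma ballot_rec n j : (2 * n.+1 * n.*2.+1)%:R * ballot n j =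
  (n.+1 * n.+2)%:R * ballot n.+1 j - (2 * tri j)%:R * ballot n.+1 j.
Proof.
rewrite tri_double -mulrBl.
have [nj|jn] := ltnP n.+1 j; first by rewrite !ballot_small ?mulr0 //; lia.
have -> : (n.+1 * n.+2)%:R - (j * j.+1)%:R = ((n.+1 - j) * (n + j).+2)%:R :> R.
  by rewrite -natrB; [congr (_%:R); nia | nia].
have nz : (n + j).+1%:R != 0 :> R by rewrite pnatr_eq0.
apply: (mulfI nz); rewrite mulrCA ballot_bin.
have -> : (n + j).+1%:R * (((n.+1 - j) * (n + j).+2)%:R * ballot n.+1 j) =
  (n + j).+1%:R * (n.+1 - j)%:R * ((n.+1 + j).+1%:R * ballot n.+1 j) by rewrite addSn natrM; ring.
rewrite ballot_bin; move: (j.*2.+1%:R : R) => w.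
suff e : (2 * n.+1 * n.*2.+1 * 'C(n.*2, n + j) =
    (n + j).+1 * (n.+1 - j) * 'C(n.+1.*2, n.+1 + j))%N.
  by rewrite mulrCA -[X in w * X = _]natrM e !natrM; ring.
rewrite doubleS addSn [in RHS]mulnAC -mul_bin_diag /=.
rewrite -mulnA [(_ * (n.+1 - j))%N]mulnC mulnA.
have [jn'|jn'] := leqP j n; last first.
  have -> : j = n.+1 by lia.
  by rewrite subnn bin_small ?muln0 ?mul0n //; lia.
have e := mul_bin_down n.*2.+1 (n + j); rewrite /= in e.
have -> : (n.+1 - j = n.*2.+1 - (n + j))%N by lia.
nia.
Qed.


(** The third bound gives convergence to 2j + 1 at rate 1/n. With b_(n,j) = (2j + 1) u_j, the u_i
    decrease by a relative amount of at most 2 (i + 1) / (n + 1) at each step, and up to j these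
    amounts add up to j (j + 1) / (n + 1). *)
Lemma rballot_bounds n j :
  [/\ 0 <= rballot n j, rballot n j <= j.*2.+1%:R &
      j.*2.+1%:R - rballot n j <= (j.*2.+1 * (2 * tri j))%:R / n.+1%:R].
Proof.
pose u i : R := 'C(n.*2, n + i)%:R / (n + i).+1%:R.
have nz i : (n + i).+1%:R != 0 :> R by rewrite pnatr_eq0.
have bu i : ballot n i = i.*2.+1%:R * u i.
  by apply: (mulfI (nz i)); rewrite ballot_bin /u mulrCA [_ * (_ / _)]mulrC divfK.
have u_ge0 i : 0 <= u i by rewrite mulr_ge0 ?invr_ge0.
have uS i : (n + i).+2%:R * u i.+1 = (n - i)%:R * u i.
  have e : (n + i).+1%:R * 'C(n.*2, (n + i).+1)%:R = (n - i)%:R * 'C(n.*2, n + i)%:R :> R.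
    by rewrite -!natrM mul_bin_left -addnn subnDl.
  have nz2 : (n + i).+2%:R != 0 :> R by rewrite pnatr_eq0.
  by apply: (mulfI (nz i)); rewrite /u addnS [(n + i).+2%:R * _]mulrC divfK // e mulrCA
    [(n + i).+1%:R * (_ / _)]mulrC divfK.
have le1 i : (n + i).+2%:R * (u i - u i.+1) <= i.+1.*2%:R * u i.
  rewrite mulrBr uS -mulrBl ler_wpM2r // lerBlDr -natrD ler_nat; lia.
have dec i : u i.+1 <= u i.
  have p : 0 < (n + i).+2%:R :> R by rewrite ltr0n.
  rewrite -(ler_pM2l p) uS ler_wpM2r // ler_nat; lia.
have u0 i : u i <= u 0%N by elim: i => // i; apply: le_trans.
have main i : n.+1%:R * (u 0%N - u i) <= (2 * tri i)%:R * u 0%N.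
  elim: i => [|i IH]; first by rewrite subrr mulr0 mulr_ge0.
  have -> : u 0%N - u i.+1 = (u 0%N - u i) + (u i - u i.+1) by rewrite addrA subrK.
  rewrite mulrDr triS mulnDr natrD mulrDl lerD // mul2n.
  apply: le_trans (ler_wpM2l _ (u0 i)) => //; apply: le_trans (le1 i).
  by rewrite ler_wpM2r ?subr_ge0 // ler_nat; lia.
have u0p : 0 < u 0%N by have := ballot0_gt0 n; rewrite bu mul1r.
have np : 0 < n.+1%:R :> R by rewrite ltr0n.
have -> : rballot n j = j.*2.+1%:R * (u j / u 0%N) by rewrite /rballot !bu mul1r mulrA.
split.
- by rewrite !mulr_ge0 // invr_ge0 ltW.
- by rewrite ler_piMr // ler_pdivrMr // mul1r.
- rewrite -{1}[j.*2.+1%:R]mulr1 -mulrBr natrM -mulrA ler_wpM2l //.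
  rewrite ler_pdivlMr // -(ler_pM2r u0p) mulrAC mulrBl mul1r divfK ?gt_eqF // mulrC.
  exact: main.
Qed.

Lemma norm_tricoef_le c k B : 0 <= B -> (forall j, (j <= k)%N -> k = tri j -> `|c j| <= B) ->
  `|tricoef c k| <= B.
Proof.
move=> B0 h; case: (tricoefP k) => [j kj ->|->]; last by rewrite normr0.
by rewrite normrM normrX normrN1 expr1n mul1r h // kj leq_tri.
Qed.

(** (k + 1)^2 is at most twice binom(k + 2, 2), a coefficient of (1 - q)^(-3). *)
Lemma l1_le_sqr r : 0 <= r -> r < 1 ->
  l1_le (fun k => k.+1%:R ^+ 2 : R) r (2 * (1 - r)^-1 ^+ 3).
Proof.
move=> r0 r1.
have convS a k : conv (fun=> 1) a k = \sum_(i < k.+1) a i :> R.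
  by rewrite convC; apply: eq_bigr => i _; rewrite mulr1.
have := l1_le_iter_conv 3 r0 (l1_le_geom r0 r1); rewrite /= conv1r => h N.
apply: le_trans (ler_wpM2l _ (h N)) => //; rewrite mulr_sumr; apply: ler_sum => k _.
rewrite mulrA ler_wpM2r ?exprn_ge0 // convS.
have -> : \sum_(i < k.+1) conv (fun=> 1) (fun=> 1) i = 'C(k.+2, 2)%:R :> R.
  elim: (nat_of_ord k) => [|m IH]; first by rewrite big_ord1 convS big_ord1.
  rewrite big_ord_recr /= IH convS sumr_const card_ord [in RHS]binS bin1 natrD.
  by rewrite addrC.
rewrite ger0_norm ?exprn_ge0 // ger0_norm ?ler0n // -natrM -natrX ler_nat.
by have := tri_double k.+1; rewrite /tri => ->; rewrite expnS expn1; nia.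
Qed.

(* The coefficients of [\prod_(m >= 1) (1 - q^m)^3], by Jacobi's identity. *)
Definition jacobi_cube : nat -> R := tricoef (fun j => j.*2.+1%:R).

(** By [jacobi_coef] the first N coefficients agree with those of the cube of the N-th finite
    product, so the first N coefficients of the inverse obey the bound A^3, which does not depend on
    N. *)
Lemma jacobi_cube_inv r : 0 <= r -> r < 1 -> exists A x, conv jacobi_cube x = fone /\ l1_le x r A.
Proof.
move=> r0 r1; have [A hA] := qpoch_inv_bound r0 r1.
have [|x xE] := @conv_inv_ex R jacobi_cube; first by rewrite /jacobi_cube tricoef0.
exists (A ^+ 3), x; split=> // N.
have [z zE hz] := hA N.
have {hz}/(_ N) := l1_le_iter_conv 3 r0 hz; apply: le_trans.
rewrite le_eqVlt; apply/predU1P; left.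
apply: eq_bigr => k _; congr (`|_| * _).
pose a k := (qpoch ('X : {poly R}) N)`_k.
have hx : conv (conv a (conv a a)) (iter 3 (conv z) fone) = fone.
  rewrite /= conv1r; have swap b c d e : conv (conv b c) (conv d e) = conv (conv b d) (conv c e).
    by rewrite -!convA; congr conv; rewrite !convA [conv c d]convC.
  by rewrite swap (swap a a z z) zE !conv1r.
apply: (conv_inv_agree _ xE hx (ltn_ord k)).
move=> i iN.
have <- : (qpoch ('X : {poly R}) N ^+ 3)`_i = conv a (conv a a) i.
  by rewrite !exprS expr0 mulr1 coefM; apply: eq_bigr => l _; rewrite coefM.
by rewrite jacobi_coef ?(ltnW iN) // /jacobi_cube (@tricoef_widen _ _ N.+1) // ltnS ltnW.
Qed.

(** Let d be the difference between Jacobi's series J and f_n. Then 1 / f_n = 1 / J + (d / J) (1 /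
    f_n), and d has norm O(1/n), so [neumann] applies for n large. *)
Lemma rballot_inv_bounded r : 0 < r -> r < 1 -> exists B n0, forall n, (n0 <= n)%N ->
  forall x, conv (tricoef (rballot n)) x = fone -> l1_le x r B.
Proof.
move=> r0 r1; have r0' := ltW r0; have [A [I [IE hI]]] := jacobi_cube_inv r0' r1.
have A0 := l1_le_ge0 hI.
pose M : R := 4 * (2 * (1 - r)^-1 ^+ 3) * A.
(* From this index on the norm of d / J is at most 1/2, whence the bound A / (1 - 1/2). *)
exists (2 * A), (Num.truncn (2 * M)) => n hn x xE.
pose d k := jacobi_cube k - tricoef (rballot n) k.
have np : 0 < n.+1%:R :> R by rewrite ltr0n.
have dk k : `|d k| <= 4 * (k.+1%:R ^+ 2) / n.+1%:R.
  rewrite /d /jacobi_cube; case: (tricoefP k) => [j kj hc|hc]; last first.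
    by rewrite !hc subrr normr0 !mulr_ge0 ?exprn_ge0 ?invr_ge0.
  have [b1 b2 b3] := rballot_bounds n j.
  rewrite !hc -mulrBr normrM normrX normrN1 expr1n mul1r ger0_norm ?subr_ge0 //.
  apply: le_trans b3 _; rewrite ler_wpM2r ?invr_ge0 // -natrX -natrM ler_nat -kj.
  by have := leq_tri j; rewrite -kj expnS expn1; nia.
have hd : l1_le d r (4 * (2 * (1 - r)^-1 ^+ 3) / n.+1%:R).
  move=> N; have := l1_le_sqr r0' r1 N => h.
  rewrite mulrAC; have h4 : 0 <= 4 / n.+1%:R :> R by rewrite mulr_ge0 ?invr_ge0.
  apply: le_trans (ler_wpM2l h4 h); rewrite mulr_sumr; apply: ler_sum => k _.
  rewrite mulrA ler_wpM2r ?exprn_ge0 // [`|k.+1%:R ^+ 2|]ger0_norm ?exprn_ge0 //.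
  by rewrite mulrAC.
have hdI := l1_le_conv r0' hd hI.
have half : 4 * (2 * (1 - r)^-1 ^+ 3) / n.+1%:R * A <= 2^-1.
  rewrite mulrAC -/M ler_pdivrMr // mulrC ler_pdivlMr // mulrC.
  by apply: ltW; apply: lt_le_trans (truncnS_gt _) _; rewrite ler_nat ltnS.
have xE' : x = I \+ conv (conv d I) x.
  have -> : conv (conv d I) x = conv I (conv d x) by rewrite [conv d I]convC convA.
  transitivity (conv I (conv (tricoef (rballot n)) x \+ conv d x)); last first.
    by rewrite convDr xE conv1r.
  rewrite -convDl.
  have -> : tricoef (rballot n) \+ d = jacobi_cube.
    by apply/funext => k; rewrite /d /= addrCA subrr addr0.
  by rewrite convA [conv I _]convC IE conv1l.
have t1 : 2^-1 < 1 :> R by rewrite invf_lt1 ?ltr1n.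
apply: l1_leW (neumann r0' t1 hI (l1_leW half hdI) xE').
have -> : 1 - 2^-1 = 2^-1 :> R by field.
by rewrite invrK mulrC.
Qed.

Lemma rballot_logder_bounded r : 0 < r -> r < 1 -> exists B n0, forall n, (n0 <= n)%N ->
  forall P, der (tricoef (rballot n)) = conv P (tricoef (rballot n)) ->
  forall k, `|P k| * r ^+ k <= B.
Proof.
move=> r0 r1; have r0' := ltW r0; have [B [n0 hB]] := rballot_inv_bounded r0 r1.
(* P is the derivative of f_n times the inverse of f_n. The derivative has coefficients at most (i +
   1) (2i + 3) <= 3 (i + 1)^2, hence the factor 3. *)
exists (3 * (2 * (1 - r)^-1 ^+ 3) * B), n0 => n hn P PE k.
have [|x xE] := @conv_inv_ex R (tricoef (rballot n)).
  by rewrite tricoef0 /rballot divff // gt_eqF // ballot0_gt0.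
have -> : P = conv (der (tricoef (rballot n))) x by rewrite PE -convA xE conv1r.
apply: l1_le_coef => //; apply: l1_le_conv => //; last exact: hB xE.
move=> N; apply: le_trans (ler_wpM2l _ (l1_le_sqr r0' r1 N)) => //.
rewrite mulr_sumr; apply: ler_sum => i _.
rewrite mulrA ler_wpM2r ?exprn_ge0 // [`|_ ^+ 2|]ger0_norm ?exprn_ge0 //.
rewrite /der normrM ger0_norm // expr2 mulrCA ler_wpM2l //.
apply: norm_tricoef_le => [|j ji _]; first by rewrite mulr_ge0.
have [b1 b2 _] := rballot_bounds n j.
rewrite ger0_norm //; apply: le_trans b2 _; rewrite -natrM ler_nat; lia.
Qed.

End Ballot.

(** * Complex values of real power series *)

Section ComplexEvaluation.
Local Open Scope ring_scope.
Local Open Scope complex_scope.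
Variable R : realType.
Local Notation C := R[i].
Implicit Types (a b : nat -> R) (u v : nat -> C) (z w : C) (r : R).

(* The modulus as an element of [R]; MathComp's [`|z|] is an element of [R[i]]. *)
Definition nm z : R := ComplexField.Normc.normc z.

Lemma nmE z : nm z = Num.sqrt (complex.Re z ^+ 2 + complex.Im z ^+ 2). Proof. by case: z. Qed.
Lemma nm0 : nm 0 = 0. Proof. exact: ComplexField.Normc.normc0. Qed.
Lemma nm1 : nm 1 = 1. Proof. exact: ComplexField.Normc.normc1. Qed.
Lemma nmM z w : nm (z * w) = nm z * nm w. Proof. exact: ComplexField.Normc.normcM. Qed.
Lemma nmD z w : nm (z + w) <= nm z + nm w. Proof. exact: le_normcD. Qed.
Lemma nmN z : nm (- z) = nm z. Proof. exact: normcN. Qed.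
Lemma nm_ge0 z : 0 <= nm z. Proof. by rewrite nmE sqrtr_ge0. Qed.
Lemma nm_eq0 z : (nm z == 0) = (z == 0).
Proof. by apply/eqP/eqP => [/ComplexField.Normc.eq0_normc|->]; last exact: nm0. Qed.
Lemma nm_real (x : R) : nm x%:C = `|x|.
Proof. by rewrite nmE /= expr0n addr0 sqrtr_sqr. Qed.
Lemma nmX z n : nm (z ^+ n) = nm z ^+ n.
Proof. by elim: n => [|n IH]; rewrite ?expr0 ?nm1 // !exprS nmM IH. Qed.
Lemma nmB z w : nm (z - w) = nm (w - z). Proof. by rewrite -nmN opprB. Qed.
Lemma nm_sum (I : Type) (s : seq I) (P : pred I) (F : I -> C) :
  nm (\sum_(i <- s | P i) F i) <= \sum_(i <- s | P i) nm (F i).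
Proof.
elim/big_rec2: _ => [|i x y _ h]; first by rewrite nm0.
by apply: le_trans (nmD _ _) _; rewrite lerD2l.
Qed.
Lemma le_Re_nm z : `|complex.Re z| <= nm z.
Proof. by rewrite nmE -sqrtr_sqr ler_wsqrtr // lerDl sqr_ge0. Qed.
Lemma le_Im_nm z : `|complex.Im z| <= nm z.
Proof. by rewrite nmE -sqrtr_sqr ler_wsqrtr // lerDr sqr_ge0. Qed.
Lemma le_nm_ReIm z : nm z <= `|complex.Re z| + `|complex.Im z|.
Proof.
rewrite nmE -[leRHS]ger0_norm ?addr_ge0 // -sqrtr_sqr ler_wsqrtr //.
by rewrite sqrrD !real_normK ?num_real // -addrA lerD2l lerDr mulrn_wge0 // mulr_ge0.
Qed.

Lemma Re_sum (I : Type) (s : seq I) (F : I -> C) :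
  complex.Re (\sum_(i <- s) F i) = \sum_(i <- s) complex.Re (F i).
Proof. by elim/big_rec2: _ => [|i x y _ <-]; [|case: (F i) y => ? ? []]. Qed.
Lemma Im_sum (I : Type) (s : seq I) (F : I -> C) :
  complex.Im (\sum_(i <- s) F i) = \sum_(i <- s) complex.Im (F i).
Proof. by elim/big_rec2: _ => [|i x y _ <-]; [|case: (F i) y => ? ? []]. Qed.

Definition clim u z := forall e : R, 0 < e -> exists N, forall n, (N <= n)%N -> nm (u n - z) < e.

Lemma clim_le u z B : (exists N, forall n, (N <= n)%N -> nm (u n) <= B) -> clim u z -> nm z <= B.
Proof.
move=> [N h] uz; apply/ler_addgt0Pr => e /uz[M hM].
have := h _ (leq_maxl N M); have := hM _ (leq_maxr N M); set x := u _ => h1 h2.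
apply: le_trans (_ : nm (x + (z - x)) <= _); first by rewrite addrC subrK.
by apply: le_trans (nmD _ _) _; rewrite lerD // nmB ltW.
Qed.

Lemma clim_cst z : clim (fun=> z) z.
Proof. by move=> e e0; exists 0%N => n _; rewrite subrr nm0. Qed.

Lemma climD u v z w : clim u z -> clim v w -> clim (fun n => u n + v n) (z + w).
Proof.
move=> uz vw e e0; have e2 : 0 < e / 2 by rewrite divr_gt0.
have [N hN] := uz _ e2; have [M hM] := vw _ e2.
exists (maxn N M) => n; rewrite geq_max => /andP[/hN h1 /hM h2].
rewrite opprD addrACA; apply: le_lt_trans (nmD _ _) _.
by rewrite [ltRHS](splitr e) ltrD.
Qed.

Lemma climZ w u z : clim u z -> clim (fun n => w * u n) (w * z).
Proof.
move=> uz e e0; have p : 0 < nm w + 1 by rewrite ltr_wpDl // nm_ge0.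
have [|N hN] := uz (e / (nm w + 1)); first by rewrite divr_gt0.
exists N => n /hN; rewrite -mulrBr nmM ltr_pdivlMr // mulrC; apply: le_lt_trans.
by rewrite ler_wpM2r ?nm_ge0 // lerDl.
Qed.

Lemma climN u z : clim u z -> clim (fun n => - u n) (- z).
Proof.
move=> uz e /uz[N hN]; exists N => n /hN; rewrite -opprD nmN; exact: id.
Qed.

Lemma climB u v z w : clim u z -> clim v w -> clim (fun n => u n - v n) (z - w).
Proof. by move=> uz vw; apply: climD => //; apply: climN. Qed.

Lemma clim_eq0 u z : clim u z -> (forall e : R, 0 < e -> exists N, forall n, (N <= n)%N -> nm (u n) <= e) -> z = 0.
Proof.
move=> uz h; apply/eqP; rewrite -nm_eq0 eq_le nm_ge0 andbT.
by apply/ler_addgt0Pr => e /h; rewrite add0r => /clim_le; apply.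
Qed.

Lemma clim_uniq u z w : clim u z -> clim u w -> z = w.
Proof.
move=> uz uw; apply/subr0_eq; apply: clim_eq0 (climB uz uw) _ => e e0.
by exists 0%N => n _; rewrite subrr nm0 ltW.
Qed.

Lemma climM u v z w : clim u z -> clim v w -> clim (fun n => u n * v n) (z * w).
Proof.
move=> uz vw.
have uv : clim (fun n => (u n - z) * (v n - w)) 0.
  move=> e e0; have [N hN] := uz _ e0; have [M hM] := vw _ ltr01.
  exists (maxn N M) => n; rewrite geq_max => /andP[/hN h1 /hM h2].
  by rewrite subr0 nmM -[ltRHS]mulr1 ltr_pM // nm_ge0.
have := climD (climD uv (climZ z vw)) (climB (climZ w uz) (clim_cst (z * w))).
have -> : 0 + z * w + (w * z - z * w) = z * w by ring.
move=> h e /h[N hN]; exists N => n /hN.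
by have -> : (u n - z) * (v n - w) + z * v n + (w * u n - z * w) = u n * v n by ring.
Qed.

Lemma clim_sum m (U : nat -> nat -> C) (Z : nat -> C) : (forall i, (i < m)%N -> clim (U i) (Z i)) ->
  clim (fun n => \sum_(i < m) U i n) (\sum_(i < m) Z i).
Proof.
elim: m => [|m IH] h e e0.
  by exists 0%N => n _; rewrite !big_ord0 subr0 nm0.
have [N hN] := climD (IH (fun i im => h i (ltnW im))) (h m (ltnSn m)) e0.
by exists N => n /hN; rewrite !big_ord_recr.
Qed.

Lemma clim_shift u z m : clim u z -> clim (fun n => u (n - m)%N) z.
Proof.
by move=> uz e /uz[N hN]; exists (N + m)%N => n hn; apply: hN; lia.
Qed.

Lemma abs_cvg (x : nat -> R) (B : R) : (forall N, \sum_(k < N) `|x k| <= B) ->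
  exists l, forall e, 0 < e -> exists N, forall n, (N <= n)%N -> `|\sum_(k < n) x k - l| < e.
Proof.
move=> hB.
have : cvgn (series x).
  apply: normed_cvg; apply: nondecreasing_is_cvgn.
    by apply: nondecreasing_series => i _ _; exact: normr_ge0.
  by exists B => _ [n _ <-]; rewrite /normed_series_of /series /= big_mkord.
move=> /cvgrPdist_lt h; exists (limn (series x)) => e /h[N _ hN].
by exists N => n /hN /=; rewrite distrC /series /= big_mkord.
Qed.

Definition psum a z N : C := \sum_(k < N) (a k)%:C * z ^+ k.

Lemma nm_psum_le a z r N : nm z <= r -> nm (psum a z N) <= \sum_(k < N) `|a k| * r ^+ k.
Proof.
move=> zr; apply: le_trans (nm_sum _ _ _) _; apply: ler_sum => k _.
by rewrite nmM nm_real nmX ler_wpM2l // lerXn2r ?nnegrE ?nm_ge0 // (le_trans _ zr) ?nm_ge0.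
Qed.

Lemma psum_cvg a z r B : l1_le a r B -> nm z <= r -> exists l, clim (psum a z) l.
Proof.
move=> ha zr.
have bnd (f : C -> R) : (forall w, `|f w| <= nm w) ->
    forall N, \sum_(k < N) `|f ((a k)%:C * z ^+ k)| <= B.
  move=> hf N; apply: le_trans (ha N); apply: ler_sum => k _.
  apply: le_trans (hf _) _; rewrite nmM nm_real nmX ler_wpM2l //.
  by rewrite lerXn2r ?nnegrE ?nm_ge0 // (le_trans _ zr) ?nm_ge0.
have [x hx] := @abs_cvg (fun k => complex.Re ((a k)%:C * z ^+ k)) B (bnd _ le_Re_nm).
have [y hy] := @abs_cvg (fun k => complex.Im ((a k)%:C * z ^+ k)) B (bnd _ le_Im_nm).
exists (x +i* y) => e e0; have e2 : 0 < e / 2 by rewrite divr_gt0.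
have [N hN] := hx _ e2; have [M hM] := hy _ e2.
exists (maxn N M) => n; rewrite geq_max => /andP[/hN h1 /hM h2].
apply: le_lt_trans (le_nm_ReIm _) _; rewrite [ltRHS](splitr e); apply: ltrD.
  have -> w : complex.Re (w - (x +i* y)) = complex.Re w - x by case: w.
  by rewrite /psum Re_sum.
have -> w : complex.Im (w - (x +i* y)) = complex.Im w - y by case: w.
by rewrite /psum Im_sum.
Qed.


(** The value 0 is only a default for divergent series. *)
Definition ev a z : C := xget 0 [set l | clim (psum a z) l]%classic.

Lemma ev_eq a z l : clim (psum a z) l -> ev a z = l.
Proof. by move=> h; apply: clim_uniq (h); apply: (@xgetPex _ 0 [set l | clim (psum a z) l]%classic); exists l. Qed.

Lemma evP a z r B : l1_le a r B -> nm z <= r -> clim (psum a z) (ev a z).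
Proof. by move=> ha zr; have [l hl] := psum_cvg ha zr; rewrite (ev_eq hl). Qed.

Lemma ev_fin a z N : (forall k, (N <= k)%N -> a k = 0) -> ev a z = psum a z N.
Proof.
move=> h; apply: ev_eq => e e0; exists N => n Nn.
rewrite -(subnKC Nn) /psum big_split_ord /= addrAC subrr add0r big1 ?nm0 // => i _.
by rewrite h ?leq_addr // mul0r.
Qed.

Lemma ev_one z : ev fone z = 1.
Proof. by rewrite (@ev_fin _ _ 1) => [|[]//]; rewrite /psum big_ord1 mulr1. Qed.

Lemma expr_small (t B e : R) : 0 <= t -> t < 1 -> 0 < e -> exists N, forall n, (N <= n)%N -> t ^+ n * B <= e.
Proof.
move=> t0 t1 e0; have p : 0 < `|B| + 1 by rewrite ltr_wpDl.
have /cvg_expr/cvgrPdist_lt/(_ _ (divr_gt0 e0 p))[N _ hN] : `|t| < 1 by rewrite ger0_norm.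
exists N => n /hN /=; rewrite sub0r normrN ger0_norm ?exprn_ge0 // ltr_pdivlMr // => h.
apply: le_trans (ltW h); rewrite ler_wpM2l ?exprn_ge0 //.
by apply: le_trans (ler_norm _) _; rewrite lerDl.
Qed.

(** The product of the partial sums and the partial sum of the product differ by terms with i + j >=
    n, where |z|^(i + j) <= (|z| / r)^n r^(i + j); the strict inequality [nm z < r] makes this tend
    to 0. *)
Lemma ev_conv a b z r A B : l1_le a r A -> l1_le b r B -> nm z < r ->
  ev (conv a b) z = ev a z * ev b z.
Proof.
move=> ha hb zr; have r0 : 0 < r by apply: le_lt_trans zr; exact: nm_ge0.
have r0' := ltW r0; have zr' := ltW zr.
have h1 := climM (evP ha zr') (evP hb zr').
have h2 := evP (l1_le_conv r0' ha hb) zr'.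
apply/esym/subr0_eq; apply: clim_eq0 (climB h1 h2) _ => e e0.
have [||N hN] := @expr_small (nm z / r) (A * B) e _ _ e0.
- by rewrite divr_ge0 ?nm_ge0.
- by rewrite ltr_pdivrMr // mul1r.
exists N => n /hN; apply: le_trans.
pose F i j := ((a i)%:C * z ^+ i) * ((b j)%:C * z ^+ j).
have -> : psum a z n * psum b z n - psum (conv a b) z n =
    \sum_(i < n) \sum_(j < n | (n <= i + j)%N) F i j.
  rewrite -sum_square_triangle /psum big_distrlr /=; congr (_ - _).
  apply: eq_bigr => k _; rewrite /conv rmorph_sum mulr_suml; apply: eq_bigr => i _.
  by rewrite rmorphM /F mulrACA -exprD subnKC // -ltnS.
apply: le_trans (nm_sum _ _ _) _.
apply: (@le_trans _ _ (\sum_(i < n) \sum_(j < n)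
    (nm z / r) ^+ n * ((`|a i| * r ^+ i) * (`|b j| * r ^+ j)))).
  apply: ler_sum => i _; apply: le_trans (nm_sum _ _ _) _.
  rewrite big_mkcond; apply: ler_sum => j _; case: ifP => nij; last first.
    by rewrite !mulr_ge0 ?exprn_ge0 ?divr_ge0 ?nm_ge0.
  rewrite /F !nmM !nm_real !nmX mulrACA [X in _ <= _ * X]mulrACA -!exprD.
  rewrite [leRHS]mulrCA ler_wpM2l ?mulr_ge0 //.
  have -> : nm z ^+ (i + j) = (nm z / r) ^+ (i + j) * r ^+ (i + j).
    by rewrite expr_div_n divfK // expf_neq0 // gt_eqF.
  rewrite ler_wpM2r ?exprn_ge0 // ler_wiXn2l //.
    by rewrite divr_ge0 ?nm_ge0.
  by rewrite ler_pdivrMr // mul1r.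
under eq_bigr do rewrite -mulr_sumr.
rewrite -mulr_sumr -big_distrlr /= ler_wpM2l ?exprn_ge0 ?divr_ge0 ?nm_ge0 //.
by apply: ler_pM (ha n) (hb n); apply: sumr_ge0 => i _; rewrite mulr_ge0 ?exprn_ge0.
Qed.

Lemma nm_ev_le a z r B : l1_le a r B -> nm z <= r -> nm (ev a z) <= B.
Proof.
move=> ha zr; apply: clim_le (evP ha zr); exists 0%N => n _.
by apply: le_trans (nm_psum_le _ _ zr) (ha n).
Qed.

Lemma ev_real a (x : R) r B : l1_le a r B -> `|x| <= r -> exists y : R, ev a x%:C = y%:C.
Proof.
move=> ha xr; exists (complex.Re (ev a x%:C)).
have h := evP ha (_ : nm x%:C <= r); rewrite nm_real in h; have {}h := h xr.
suff : complex.Im (ev a x%:C) = 0 by case: (ev _ _) => u v /= ->.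
apply/eqP; rewrite -normr_eq0 eq_le normr_ge0 andbT; apply/ler_addgt0Pr => e /h[N hN].
rewrite add0r; apply: le_trans (ltW (hN N (leqnn _))); apply: le_trans (le_Im_nm _).
have -> : psum a x%:C N = (\sum_(k < N) a k * x ^+ k)%:C.
  by rewrite /psum rmorph_sum; apply: eq_bigr => k _; rewrite rmorphM rmorphXn.
by case: (ev _ _) => u v /=; rewrite sub0r normrN.
Qed.

(* Re-expansion of a power series at a point [z] of its disk of convergence. *)
Definition shift_coef a m k : R := 'C(k + m, m)%:R * a (k + m)%N.

(** binom(k + m, m) x^k y^m is a single term in the expansion of (x + y)^(k + m). *)
Lemma l1_le_shift a m (x y : R) B : 0 <= x -> 0 < y -> l1_le a (x + y) B ->
  l1_le (shift_coef a m) x (B / y ^+ m).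
Proof.
move=> x0 y0 ha N; rewrite ler_pdivlMr ?exprn_gt0 //.
apply: le_trans (ha (N + m)%N); rewrite mulr_suml addnC big_split_ord /=.
rewrite -[leLHS]add0r lerD ?sumr_ge0 //.
  by move=> i _; rewrite mulr_ge0 ?exprn_ge0 // addr_ge0 // ltW.
apply: ler_sum => k _; rewrite /shift_coef normrM ger0_norm // addnC.
rewrite -mulrA -mulrA mulrCA ler_wpM2l // exprDn.
have mk : (m < (m + k).+1)%N by rewrite ltnS leq_addr.
rewrite (bigD1 (Ordinal mk)) //= addKn -[X in _ <= X + _]mulr_natl lerDl sumr_ge0 // => i _.
by rewrite mulrn_wge0 // mulr_ge0 // exprn_ge0 // ltW.
Qed.

Lemma ev_reexpand a z (y : R) B h : 0 < y -> l1_le a (nm z + 2 * y) B -> nm h < y ->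
  clim (fun N => \sum_(m < N) ev (shift_coef a m) z * h ^+ m) (ev a (z + h)).
Proof.
move=> y0 ha hy.
have z0 := nm_ge0 z; have y0' := ltW y0.
(* s bounds |z| + |h| and lies below the radius r of the hypothesis; the remainder will be of order
   (s / r)^n. *)
pose s := nm z + y; pose r := nm z + 2 * y.
have s0 : 0 < s by rewrite ltr_wpDl.
have r0 : 0 < r by rewrite ltr_wpDl // mulr_gt0.
have sr : s < r by rewrite ltrD2l ltr_pMl // ltr1n.
have zh : nm (z + h) <= r.
  by apply: le_trans (nmD _ _) _; rewrite lerD2l (le_trans (ltW hy)) // ler_pMl // ler1n.
have c1 := evP ha zh.
have c2 m : clim (psum (shift_coef a m) z) (ev (shift_coef a m) z).
  apply: evP (l1_le_shift m z0 _ ha) _ => //; exact: mulr_gt0.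
move=> e e0.
have [||N hN] := @expr_small (s / r) B (e / 2) _ _ (divr_gt0 e0 (ltr0n _ 2)).
- by rewrite divr_ge0 // ltW.
- by rewrite ltr_pdivrMr // mul1r.
exists N => n Nn; apply: le_lt_trans (_ : e / 2 < e); last first.
  by rewrite ltr_pdivrMr // ltr_pMr // ltr1n.
apply: le_trans (hN n Nn); rewrite nmB.
have c3 : clim (fun M => \sum_(m < n) h ^+ m * psum (shift_coef a m) z (M - m))
    (\sum_(m < n) h ^+ m * ev (shift_coef a m) z).
  apply: (@clim_sum n (fun m M => h ^+ m * psum (shift_coef a m) z (M - m))
    (fun m => h ^+ m * ev (shift_coef a m) z)) => m _.
  exact: (climZ (h ^+ m) (clim_shift m (c2 m))).
under [X in _ - X]eq_bigr do rewrite mulrC.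
apply: clim_le (climB c1 c3); exists n => M nM; cbv beta.
pose F m j : C := ('C(m + j, m)%:R * a (m + j)%N)%:C * z ^+ j * h ^+ m.
have -> : psum a (z + h) M = \sum_(m < M) \sum_(j < M - m) F m j.
  rewrite -sum_triangle; apply: eq_bigr => k _.
  rewrite exprDn mulr_sumr; apply: eq_bigr => i _.
  by rewrite /F subnKC ?leq_ord // rmorphM rmorph_nat mulrnAr -[LHS]mulr_natl !mulrA.
have -> : \sum_(m < n) h ^+ m * psum (shift_coef a m) z (M - m) =
    \sum_(m < n) \sum_(j < M - m) F m j.
  apply: eq_bigr => m _; rewrite /psum mulr_sumr; apply: eq_bigr => j _.
  by rewrite /F /shift_coef addnC; ring.
rewrite (big_ord_widen _ (fun m => \sum_(j < M - m) F m j) nM).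
rewrite (bigID (fun m : 'I_M => (m < n)%N)) /= addrAC subrr add0r.
apply: le_trans (nm_sum _ _ _) _.
(* For m >= n the factor (s / r)^n (r / s)^(m + j) is at least 1. As (|z| + y) r / s = r, the
   binomial theorem sums these majorants to (s / r)^n times a partial sum of the norm of a. *)
pose G m j : R := (s / r) ^+ n * ('C(m + j, m)%:R * (nm z * (r / s)) ^+ j * (y * (r / s)) ^+ m * `|a (m + j)%N|).
have G0 m j : 0 <= G m j.
  by rewrite !mulr_ge0 ?exprn_ge0 ?invr_ge0 ?mulr_ge0 ?invr_ge0 ?(ltW s0) ?(ltW r0).
apply: (@le_trans _ _ (\sum_(m < M) \sum_(j < M - m) G m j)).
  rewrite big_mkcond; apply: ler_sum => m _; case: ifP => nm_; last by apply: sumr_ge0 => j _.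
  apply: le_trans (nm_sum _ _ _) _; apply: ler_sum => j _.
  rewrite /F /G !nmM nm_real !nmX normrM normr_nat.
  set w := 'C(_, _)%:R.
  have -> : (s / r) ^+ n * (w * (nm z * (r / s)) ^+ j * (y * (r / s)) ^+ m * `|a (m + j)%N|) =
     w * `|a (m + j)%N| * nm z ^+ j * (y ^+ m * ((s / r) ^+ n * (r / s) ^+ (m + j))).
    by rewrite [(r / s) ^+ (m + j)]exprD !exprMn; ring.
  rewrite ler_wpM2l ?mulr_ge0 ?exprn_ge0 //.
  apply: (@le_trans _ _ (y ^+ m)); first by rewrite lerXn2r ?nnegrE ?nm_ge0 // ltW.
  rewrite ler_peMr ?exprn_ge0 // -[s / r]invf_div exprVn ler_pdivlMl ?exprn_gt0 ?divr_gt0 // mulr1.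
  apply: ler_weXn2l; first by rewrite ler_pdivlMr // mul1r ltW.
  by move: nm_; lia.
have -> : \sum_(m < M) \sum_(j < M - m) G m j = (s / r) ^+ n * \sum_(k < M) `|a k| * r ^+ k.
  rewrite -sum_triangle mulr_sumr; apply: eq_bigr => k _; rewrite /G -mulr_sumr.
  congr (_ * _); have -> : r = nm z * (r / s) + y * (r / s).
    by rewrite -mulrDl mulrC divfK // gt_eqF.
  rewrite exprDn mulr_sumr; apply: eq_bigr => i _.
  rewrite subnKC ?leq_ord // -[X in _ = _ * X]mulr_natl.
  by rewrite -mulrDl [_ * (r / s)]mulrC divfK ?gt_eqF // mulrC !mulrA.
by rewrite ler_wpM2l ?exprn_ge0 ?divr_ge0 ?(ltW s0) ?(ltW r0) // ha.
Qed.

End ComplexEvaluation.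

(** * Absence of zeros in the unit disk *)

Section Nonvanishing.
Local Open Scope ring_scope.
Local Open Scope complex_scope.
Variable R : realType.
Local Notation C := R[i].

Lemma deriv_prod_XsubC (s : seq C) (z : C) : z \notin s ->
  (\prod_(x <- s) ('X - x%:P))^`().[z] =
  (\prod_(x <- s) ('X - x%:P)).[z] * \sum_(x <- s) (z - x)^-1.
Proof.
elim: s => [|x s IH]; first by rewrite !big_nil derivC hornerC mulr0.
rewrite inE negb_or => /andP[zx zs].
rewrite !big_cons derivM derivXsubC mul1r hornerD !hornerM IH // hornerXsubC.
by rewrite mulrDr mulrAC mulfV ?subr_eq0 // mul1r mulrA.
Qed.

(** For w = z / (z - x) the hypothesis reads |w| <= |1 - w|: w is at least as close to 0 as to 1. *)
Lemma Re_ratio_le (z x : C) : z != x -> nm z <= nm x -> 2 * complex.Re (z / (z - x)) <= 1.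
Proof.
move=> zx; rewrite -subr_eq0 in zx; set w := z / (z - x).
have e : 1 - w = - x / (z - x) by rewrite /w -{1}(mulfV zx) -mulrBl; congr (_ / _); ring.
have nz : 0 < nm (z - x) by rewrite lt_neqAle eq_sym nm_eq0 zx nm_ge0.
have nw : nm w * nm (z - x) = nm z by rewrite -nmM divfK.
have nw1 : nm (1 - w) * nm (z - x) = nm x by rewrite -nmM e divfK // nmN.
rewrite -nw -nw1 (ler_pM2r nz) -(@ler_pXn2r _ 2) ?nnegrE ?nm_ge0 //.
rewrite !nmE !sqr_sqrtr ?addr_ge0 ?sqr_ge0 //.
by case: w {e nw nw1} => a b /=; rewrite sub0r; lra.
Qed.

Definition fpoly n : {poly C} := \poly_(k < (tri n).+1) (tricoef (rballot R n) k)%:C.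

Lemma tricoef_rballot_small n k : (tri n < k)%N -> tricoef (rballot R n) k = 0.
Proof.
move=> nk; case: (tricoefP R k) => [j kj ->|->//].
rewrite /rballot ballot_small ?mul0r ?mulr0 //; rewrite kj in nk.
rewrite ltnNge; apply/negP => jn.
have := tri_double j; have := tri_double n; nia.
Qed.

Lemma coef_fpoly n k : (fpoly n)`_k = (tricoef (rballot R n) k)%:C.
Proof. by rewrite coef_poly; case: ltnP => // h; rewrite tricoef_rballot_small. Qed.

Lemma tricoef_rballot0 n : tricoef (rballot R n) 0 = 1.
Proof. by rewrite tricoef0 /rballot divff // gt_eqF // ballot0_gt0. Qed.

Lemma fpoly_neq0 n : fpoly n != 0.
Proof.
apply/eqP => /(congr1 (fun p : {poly C} => p`_0)); rewrite coef_fpoly coef0 tricoef_rballot0.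
by move/eqP; rewrite oner_eq0.
Qed.

(** Multiplying the coefficient of q^(tri j) by [tri j] is the operator q d/dq, so this is
    [ballot_rec] read coefficientwise. *)
Lemma fpoly_rec n : ((2 * n.+1 * n.*2.+1)%:R * ballot R n 0)%:C *: fpoly n =
  (ballot R n.+1 0)%:C *:
    ((n.+1 * n.+2)%:R *: fpoly n.+1 - 2 *: ('X * (fpoly n.+1)^`())).
Proof.
apply/polyP => k; rewrite !(coefZ, coefB) coefXM coef_deriv !coef_fpoly.
have -> : (if k == 0%N then 0 else (tricoef (rballot R n.+1) k.-1.+1)%:C *+ k.-1.+1) =
    k%:R * (tricoef (rballot R n.+1) k)%:C.
  case: k => [|k]; first by rewrite mul0r.
  by rewrite mulr_natl.
have b0 := ballot0_gt0 R n; have b1 := ballot0_gt0 R n.+1.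
rewrite -(rmorph_nat (real_complex R) (n.+1 * n.+2)) -(rmorph_nat (real_complex R) 2).
rewrite -(rmorph_nat (real_complex R) k) -!rmorphM -rmorphB -rmorphM; congr (_%:C).
case: (tricoefP R k) => [j kj hc|hc]; rewrite !hc ?mulr0 ?subrr ?mulr0 //.
rewrite kj /rballot; have := ballot_rec R n j; rewrite [(2 * tri j)%:R]natrM.
move: (2 * n.+1 * n.*2.+1)%:R (n.+1 * n.+2)%:R (tri j)%:R (ballot R n j) => x y t u e.
have nz0 := lt0r_neq0 b0; have nz1 := lt0r_neq0 b1.
transitivity ((-1) ^+ j * (x * u)); first by field.
by rewrite e; field.
Qed.

(** At a zero z of f_n the recursion reads (n + 1) (n + 2) = 2 z f'(z) / f(z) with f = f_(n+1), the
    sum of 2z / (z - x) over the roots x of f. Each term has real part at most 1, and there are at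
    most (n + 1) (n + 2) / 2 of them. *)
Lemma fpoly_descent n r : (forall z : C, nm z < r -> (fpoly n.+1).[z] != 0) ->
  forall z : C, nm z < r -> (fpoly n).[z] != 0.
Proof.
move=> h z zr; apply/negP => /eqP f0.
have [s sE] := closed_field_poly_normal (fpoly n.+1).
have lc : lead_coef (fpoly n.+1) != 0 by rewrite lead_coef_eq0 fpoly_neq0.
have s_size : (size s <= tri n.+1)%N.
  rewrite -ltnS -(size_prod_XsubC s id) -(size_scale _ lc) -sE; exact: size_poly.
have s_root x : x \in s -> r <= nm x.
  move=> xs; rewrite leNgt; apply/negP => /h; rewrite sE hornerZ.
  by rewrite (_ : _.[x] = 0) ?mulr0 ?eqxx //; apply/rootP; rewrite root_prod_XsubC.
have zs : z \notin s by apply/negP => /s_root; rewrite leNgt zr.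
have := congr1 (fun p : {poly C} => p.[z]) (fpoly_rec n).
rewrite !(hornerZ, hornerD, hornerN, hornerM, hornerX) f0 mulr0 => /esym/eqP.
have b1 := ballot0_gt0 R n.+1.
rewrite mulf_eq0 (fmorph_eq0 (real_complex R)) gt_eqF //= subr_eq0 => /eqP.
have -> : (fpoly n.+1)^`().[z] = (fpoly n.+1).[z] * \sum_(x <- s) (z - x)^-1.
  move: (lead_coef _) sE => c ->.
  by rewrite derivZ !hornerZ deriv_prod_XsubC // mulrA.
have -> (p S : C) : 2 * (z * (p * S)) = p * (2 * (z * S)) by ring.
rewrite [(n.+1 * n.+2)%:R * _]mulrC => /(mulfI (h z zr)).
rewrite !mulr_sumr => /(congr1 (@complex.Re R)); rewrite Re_sum.
have -> : complex.Re ((n.+1 * n.+2)%:R : C) = (n.+1 * n.+2)%:R.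
  by rewrite -(rmorph_nat (real_complex R)).
move=> e; have : (n.+1 * n.+2)%:R <= (tri n.+1)%:R :> R.
  rewrite e; apply: (@le_trans _ _ (size s)%:R); last by rewrite ler_nat.
  rewrite -sum1_size natr_sum big_seq [leRHS]big_seq; apply: ler_sum => x xs.
  have -> : complex.Re (2 * (z * (z - x)^-1)) = 2 * complex.Re (z / (z - x)).
    by case: (z / _) => u v /=; simpc.
  apply: Re_ratio_le; first by apply: contraNneq zs => ->.
  by rewrite (le_trans (ltW zr)) ?s_root.
rewrite ler_nat; have := tri_double n.+1; lia.
Qed.

Lemma l1_le_rballot n r : 0 <= r -> r < 1 ->
  l1_le (tricoef (rballot R n)) r (2 * (1 - r)^-1 ^+ 3).
Proof.
move=> r0 r1; apply: l1_le_mono (l1_le_sqr r0 r1) => // k.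
rewrite [leRHS]ger0_norm ?exprn_ge0 //; apply: norm_tricoef_le => [|j jk _]; first exact: exprn_ge0.
have [b1 b2 _] := rballot_bounds R n j.
by rewrite ger0_norm //; apply: le_trans b2 _; rewrite -natrX ler_nat expnS expn1; nia.
Qed.

Lemma ev_rballot n (z : C) : ev (tricoef (rballot R n)) z = (fpoly n).[z].
Proof.
rewrite (@ev_fin _ _ _ (tri n).+1) => [|k]; last exact: tricoef_rballot_small.
by rewrite horner_poly.
Qed.

Lemma fpoly_nonzero n (z : C) : nm z < 1 -> (fpoly n).[z] != 0.
Proof.
move=> z1; pose r := (nm z + 1) / 2.
have zr : nm z < r by rewrite midf_lt.
have r1 : r < 1 by rewrite midf_lt.
have r0 : 0 < r by apply: le_lt_trans zr; exact: nm_ge0.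
have [B [n0 hB]] := rballot_inv_bounded r0 r1.
have main m : (n0 <= m)%N -> forall w : C, nm w < r -> (fpoly m).[w] != 0.
  move=> hm w wr; have [x xE] := conv_inv_ex (tricoef_rballot0 m).
  have hx := hB m hm x xE.
  have hf : l1_le (tricoef (rballot R m)) r (2 * (1 - r)^-1 ^+ 3) by exact: l1_le_rballot (ltW r0) r1.
  have := ev_conv hf hx wr; rewrite xE ev_one ev_rballot => e.
  by apply/eqP => f0; move: e; rewrite f0 mul0r => /eqP; rewrite oner_eq0.
(* Descent from an index beyond n0 down to n. Once d reaches [maxn n n0], truncated subtraction
   makes the step trivial. *)
have : forall d w, nm w < r -> (fpoly (maxn n n0 - d)).[w] != 0.
  elim=> [|d IH]; first by rewrite subn0; apply: main; rewrite leq_maxr.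
  have [le|gt] := leqP (maxn n n0) d.
    by have -> : (maxn n n0 - d.+1 = maxn n n0 - d)%N by lia.
  apply: fpoly_descent; have -> : ((maxn n n0 - d.+1).+1 = maxn n n0 - d)%N by lia.
  exact: IH.
move=> /(_ (maxn n n0 - n)%N z zr); rewrite subKn //; exact: leq_maxl.
Qed.

(* The coefficients of the logarithmic derivative are, up to sign, the power sums of the
   inverses of the roots, all of which lie outside the open unit disk. *)
Lemma rballot_logder_le n P :
  der (tricoef (rballot R n)) = conv P (tricoef (rballot R n)) ->
  forall k, `|P k| <= (tri n)%:R.
Proof.
move=> PE k.
have [s sE] := closed_field_poly_normal (fpoly n).
have lc : lead_coef (fpoly n) != 0 by rewrite lead_coef_eq0 fpoly_neq0.
have s_size : (size s <= tri n)%N.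
  rewrite -ltnS -(size_prod_XsubC s id) -(size_scale _ lc) -sE; exact: size_poly.
have s_root x : x \in s -> 1 <= nm x.
  move=> xs; rewrite leNgt; apply/negP => /(fpoly_nonzero n); rewrite sE hornerZ.
  by rewrite (_ : _.[x] = 0) ?mulr0 ?eqxx //; apply/rootP; rewrite root_prod_XsubC.
have s_neq0 x : x \in s -> x != 0.
  by move=> /s_root; apply: contraTneq => ->; rewrite nm0 ler10.
(* [- x^-1 ^+ j.+1] is the coefficient of q^j in 1 / (q - x), the logarithmic derivative of q -
   x. *)
pose pw (t : seq C) (j : nat) : C := - \sum_(x <- t) x^-1 ^+ j.+1.
pose co (p : {poly C}) (j : nat) : C := p`_j.
have pwE t : (forall x, x \in t -> x != 0) ->
    der (co (\prod_(x <- t) ('X - x%:P))) = conv (pw t) (co (\prod_(x <- t) ('X - x%:P))).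
  elim: t => [|x t IH] ht.
    apply/funext => j; rewrite /der /co /conv big_nil coef1 mulr0 big1 // => i _.
    by rewrite /pw big_nil oppr0 mul0r.
  have x0 : x != 0 by apply: ht; rewrite inE eqxx.
  rewrite big_cons.
  have coM (p q : {poly C}) : co (p * q) = conv (co p) (co q).
    by apply/funext => j; rewrite /co coefM.
  rewrite coM der_conv IH; last by move=> y yt; apply: ht; rewrite inE yt orbT.
  have -> : pw (x :: t) = (fun j => - x^-1 ^+ j.+1) \+ pw t.
    by apply/funext => j; rewrite /pw big_cons opprD.
  rewrite convDl; congr (_ \+ _); last by rewrite convA [conv (co _) (pw t)]convC -convA.
  rewrite convA; congr conv; apply/funext => j.
  rewrite /der /co /conv coefB coefX coefC subr0 eqSS.
  case: j => [|j].
    by rewrite big_ord1 coefB coefX coefC /= mulr1 sub0r mulNr mulrN opprK mulVf.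
  rewrite mulr0 big_ord_recr big_ord_recr /= subnn big1 ?add0r => [|i _]; last first.
    rewrite coefB coefX coefC; have := ltn_ord i => hi.
    by rewrite !ifF ?gtn_eqF ?subrr ?mulr0 //; lia.
  rewrite subSnn !coefB !coefX !coefC /= subr0 sub0r mulr1 mulNr mulrN opprK.
  by rewrite [x^-1 ^+ j.+2]exprSr divfK // addNr.
pose F j : C := (tricoef (rballot R n) j)%:C.
have FE : F = co (fpoly n) by apply/funext => j; rewrite /F -coef_fpoly.
have F0 : F 0%N = 1 by rewrite /F tricoef_rballot0.
have dF : der F = conv (pw s) F.
  have sE' : F = (fun j => lead_coef (fpoly n) * co (\prod_(x <- s) ('X - x%:P)) j).
    by rewrite FE {1}sE; apply/funext => j; rewrite /co coefZ.
  rewrite sE'; apply/funext => j; rewrite /der mulrCA -/(der _ _) pwE // /conv mulr_sumr.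
  by apply: eq_bigr => i _; rewrite mulrCA.
have dF' : der F = conv (fun j => (P j)%:C) F.
  apply/funext => j; have := congr1 (fun u : nat -> R => (u j)%:C) PE.
  rewrite /= /der rmorphM rmorph_nat => ->; rewrite /conv rmorph_sum.
  by apply: eq_bigr => i _; rewrite rmorphM.
have -> : `|P k| = nm (pw s k).
  by rewrite -nm_real; congr nm; rewrite (conv_cancel F0 (etrans (esym dF) dF')).
rewrite /pw nmN; apply: le_trans (nm_sum _ _ _) _.
apply: (@le_trans _ _ (size s)%:R); last by rewrite ler_nat.
rewrite -sum1_size natr_sum big_seq [leRHS]big_seq; apply: ler_sum => x xs.
rewrite nmX exprn_ile1 ?nm_ge0 // /nm ComplexField.Normc.normcV -/(nm x).
by rewrite invf_le1 ?s_root // (lt_le_trans ltr01) ?s_root.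
Qed.

End Nonvanishing.

(** * The 2n-th roots as power series *)

Section Roots.
Local Open Scope ring_scope.
Local Open Scope complex_scope.
Variable R : realType.
Local Notation C := R[i].
Implicit Types (P : nat -> R) (z : C) (r : R).

Lemma l1_le_fexp_ex P m r : (forall k, `|P k| <= m%:R) -> 0 <= r -> r < 1 ->
  exists B, l1_le (fexp P) r B.
Proof. by move=> Pm r0 r1; eexists; apply: l1_le_fexp Pm. Qed.

Lemma between_nm z : nm z < 1 -> exists r, [/\ 0 < r, r < 1 & nm z < r].
Proof.
move=> z1; exists ((nm z + 1) / 2); have zr : nm z < (nm z + 1) / 2 by rewrite midf_lt.
by split=> //; [apply: le_lt_trans zr; exact: nm_ge0 | rewrite midf_lt].
Qed.

Lemma ev_fexpD P Q m z : (forall k, `|P k| <= m%:R) -> (forall k, `|Q k| <= m%:R) -> nm z < 1 ->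
  ev (fexp (P \+ Q)) z = ev (fexp P) z * ev (fexp Q) z.
Proof.
move=> Pm Qm /between_nm[r [r0 r1 zr]].
have [A hA] := l1_le_fexp_ex Pm (ltW r0) r1; have [B hB] := l1_le_fexp_ex Qm (ltW r0) r1.
by rewrite fexpD (ev_conv hA hB zr).
Qed.

Lemma ev_fexpN P m z : (forall k, `|P k| <= m%:R) -> nm z < 1 ->
  ev (fexp P) z * ev (fexp (fun k => - P k)) z = 1.
Proof.
move=> Pm z1; rewrite -(@ev_fexpD _ _ m) // => [|k]; last by rewrite normrN.
by rewrite fexpD fexpN ev_one.
Qed.

Lemma ev_fexp_natmul P m n z : (forall k, `|P k| <= m%:R) -> nm z < 1 ->
  ev (fexp (fun k => n%:R * P k)) z = ev (fexp P) z ^+ n.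
Proof.
move=> Pm z1; have /between_nm[r [r0 r1 zr]] := z1.
have [A hA] := l1_le_fexp_ex Pm (ltW r0) r1.
rewrite fexp_natmul; elim: n => [|n IH]; first exact: ev_one.
by rewrite /= (ev_conv hA (l1_le_iter_conv n (ltW r0) hA) zr) IH exprS.
Qed.

Lemma ev_fexp_cst (n : nat) z : nm z < 1 -> ev (fexp (fun=> n%:R)) z = (1 - z) ^- n.
Proof.
move=> z1.
have z1' : 1 - z != 0.
  by rewrite subr_eq0; apply: contraTneq z1 => <-; rewrite nm1 ltxx.
have -> : (fun=> n%:R) = (fun k => n%:R * (fun=> 1) k) :> (nat -> R).
  by apply/funext => k; rewrite mulr1.
rewrite (@ev_fexp_natmul _ 1) ?normr1 // -exprVn; congr (_ ^+ _).
apply: (mulIf z1'); rewrite mulVf //.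
have h1 (k : nat) : `|1| <= 1%:R :> R by rewrite normr1.
have := @ev_fexpN (fun=> 1) 1 z h1 z1; rewrite fexp_oneN.
rewrite [X in _ * X](@ev_fin _ _ _ 2) => [|[|[|k _]]//]; last by rewrite subrr.
rewrite /psum !big_ord_recr big_ord0 /= add0r subr0 sub0r expr0 mulr1 expr1.
by rewrite rmorph1 rmorphN1 mulN1r.
Qed.

(** The value is the square of the real value of the exponential of P / 2, and it is nonzero because
    the exponential of - P inverts it. *)
Lemma ev_fexp_gt0 P m (x : R) : (forall k, `|P k| <= m%:R) -> `|x| < 1 ->
  exists2 y, 0 < y & ev (fexp P) x%:C = y%:C.
Proof.
move=> Pm x1; have x1' : nm x%:C < 1 by rewrite nm_real.
have hm k : `|P k / 2| <= m%:R.
  by rewrite normrM; apply: le_trans (Pm k); rewrite ler_piMr // ger0_norm ?invr_ge0 // invf_le1 ?ler1n.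
have [r [r0 r1 xr]] := between_nm x1'; rewrite nm_real in xr.
have [B hB] := l1_le_fexp_ex hm (ltW r0) r1.
have [y yE] := ev_real hB (ltW xr).
have e2 : ev (fexp P) x%:C = (y ^+ 2)%:C.
  rewrite rmorphXn /= -yE -(ev_fexp_natmul 2 hm) //; congr (ev (fexp _) _).
  by apply/funext => k; rewrite mulrC divfK ?pnatr_eq0.
exists (y ^+ 2) => //; rewrite lt_neqAle sqr_ge0 andbT eq_sym.
apply/eqP => y0; have := ev_fexpN Pm x1'; rewrite e2 y0 mul0r => /eqP.
by rewrite eq_sym oner_eq0.
Qed.

Lemma logder_ex n : exists P, der (tricoef (rballot R n)) = conv P (tricoef (rballot R n)).
Proof.
have [x xE] := conv_inv_ex (tricoef_rballot0 R n).
by exists (conv (der (tricoef (rballot R n))) x); rewrite -convA [conv x _]convC xE conv1r.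
Qed.

Definition logder n : nat -> R := sval (cid (logder_ex n)).

Lemma logderP n : der (tricoef (rballot R n)) = conv (logder n) (tricoef (rballot R n)).
Proof. by rewrite /logder; case: cid. Qed.

Lemma fexp_logder n : fexp (logder n) = tricoef (rballot R n).
Proof. by apply/esym/fexp_uniq; [exact: tricoef_rballot0 | exact: logderP]. Qed.

Lemma logder_le n k : `|logder n k| <= (tri n)%:R.
Proof. exact: rballot_logder_le (logderP n) k. Qed.

(** The logarithmic derivative of the 2n-th root of f_n; for n = 0 the division by 0 gives 0. *)
Definition root_exp n (k : nat) : R := logder n k / n.*2%:R.
(* The coefficients of the [2n]-th root of [fpoly n / (1 - q)^n]. *)
Definition root_coef n : nat -> R := fexp (fun k => root_exp n k + 2^-1).

Lemma root_exp_le n k : `|root_exp n k| <= (tri n).+1%:R.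
Proof.
rewrite /root_exp; case: n => [|n]; first by rewrite invr0 mulr0 normr0.
rewrite normrM; apply: le_trans (_ : (tri n.+1)%:R <= _); last by rewrite ler_nat.
apply: le_trans (logder_le _ k); rewrite ler_piMr // normfV normr_nat.
by rewrite invf_le1 ?ltr0n // ler1n.
Qed.

Lemma half_le n : `|2^-1| <= n.+1%:R :> R.
Proof.
rewrite ger0_norm ?invr_ge0 //; apply: (@le_trans _ _ 1); last by rewrite ler1n.
by rewrite invf_le1 ?ler1n.
Qed.

Lemma root_coef_exp_le n k : `|root_exp n k + 2^-1| <= ((tri n).+1 + 1)%:R.
Proof.
by rewrite natrD; apply: le_trans (ler_normD _ _) _; rewrite lerD ?root_exp_le // (half_le 0).
Qed.

(** 2n times the exponent is [logder n] plus the constant n, the logarithmic derivatives of f_n and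
    of (1 - q)^(-n). *)
Lemma ev_root_coefX n z : (0 < n)%N -> nm z < 1 ->
  ev (root_coef n) z ^+ n.*2 = (fpoly R n).[z] * (1 - z) ^- n.
Proof.
move=> n0 z1; rewrite -(ev_fexp_natmul n.*2 (root_coef_exp_le n) z1).
have -> : (fun k => n.*2%:R * (root_exp n k + 2^-1)) = logder n \+ (fun=> n%:R).
  apply/funext => k; rewrite /root_exp mulrDr mulrC divfK /=.
    by rewrite -muln2 natrM mulfK ?pnatr_eq0.
  by rewrite pnatr_eq0 double_eq0 -lt0n.
rewrite (@ev_fexpD _ _ (tri n + n)) //.
- by rewrite fexp_logder ev_rballot ev_fexp_cst.
- by move=> k; apply: le_trans (logder_le n k) _; rewrite ler_nat leq_addr.
- by move=> k; rewrite normr_nat ler_nat leq_addl.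
Qed.

(* The coefficients of [(1 - q)^(-1/2)]. *)
Definition half_coef : nat -> R := fexp (fun=> 2^-1).

Lemma ev_root_coefE n z : nm z < 1 -> ev (root_coef n) z = ev (fexp (root_exp n)) z * ev half_coef z.
Proof.
by move=> z1; apply: (@ev_fexpD _ (fun=> _) (tri n).+1) => // k; [exact: root_exp_le | exact: half_le].
Qed.

(** The exponent has coefficients of order t^(-k) / n, uniformly in n. [norm_fexp_small] carries
    this over to the exponential, whose value without its constant term is then O(1/n). *)
Lemma root_exp_cvg (r e : R) : 0 <= r -> r < 1 -> 0 < e ->
  exists N, forall n, (N <= n)%N -> forall z, nm z <= r -> nm (ev (fexp (root_exp n)) z - 1) <= e.
Proof.
move=> r0 r1 e0; pose t := (r + 1) / 2.
have rt : r < t by rewrite midf_lt.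
have t1 : t < 1 by rewrite midf_lt.
have t0 : 0 < t by apply: le_lt_trans rt.
have [B [n0 hB]] := rballot_logder_bounded t0 t1.
have B0 : 0 <= B.
  by apply: le_trans (hB n0 (leqnn _) _ (logderP n0) 0%N); rewrite expr0 mulr1.
have q0 : 0 <= r / t by rewrite divr_ge0 // ltW.
have q1 : r / t < 1 by rewrite ltr_pdivrMr // mul1r.
(* The two summands make n large enough for s <= 1 and for s / (1 - r / t) <= e, where s = B /
   (2n). *)
pose D := B + B * (1 - r / t)^-1 / e.
have p1 : 0 < 1 - r / t by rewrite subr_gt0.
have D0 : 0 <= B * (1 - r / t)^-1 / e by rewrite !mulr_ge0 // invr_ge0 ltW.
exists (maxn n0 (Num.truncn D).+1) => n; rewrite geq_max => /andP[hn hD] z zr.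
have n_gt0 : 0 < n.*2%:R :> R by rewrite ltr0n double_gt0; apply: leq_trans hD.
have Dn : D <= n.*2%:R.
  apply: ltW; apply: lt_le_trans (truncnS_gt _) _; rewrite ler_nat -addnn.
  by apply: leq_trans hD _; rewrite leq_addr.
pose s := B / n.*2%:R.
have s0 : 0 <= s by rewrite divr_ge0.
have s1 : s <= 1 by rewrite ler_pdivrMr // mul1r; apply: le_trans Dn; rewrite lerDl.
have small k : `|fexp (root_exp n) k.+1| <= s * t^-1 ^+ k.+1.
  apply: norm_fexp_small => //; first by rewrite invr_ge0 ltW.
  move=> j; rewrite /root_exp normrM normfV normr_nat /s mulrAC ler_pM2r ?invr_gt0 //.
  rewrite exprVn ler_pdivlMr ?exprn_gt0 //; apply: le_trans (hB n hn _ (logderP n) j).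
  by rewrite ler_wpM2l // ler_wiXn2l // ltW.
have [A hA] := l1_le_fexp_ex (root_exp_le n) r0 r1.
apply: clim_le (climB (evP hA zr) (clim_cst 1)); exists 1%N => -[//|M] _.
rewrite /psum big_ord_recl fexp0 expr0 mulr1 addrAC subrr add0r.
apply: le_trans (nm_sum _ _ _) _.
apply: (@le_trans _ _ (s * \sum_(k < M) (r / t) ^+ k)).
  rewrite mulr_sumr; apply: ler_sum => k _; rewrite nmM nm_real nmX /=.
  apply: (@le_trans _ _ (s * (r / t) ^+ k.+1)).
    rewrite expr_div_n -exprVn [r ^+ _ * _]mulrC mulrA.
    by apply: ler_pM; rewrite ?exprn_ge0 ?nm_ge0 ?small // lerXn2r ?nnegrE ?nm_ge0.
  by rewrite ler_wpM2l // ler_wiXn2l // ltW.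
apply: le_trans (ler_wpM2l s0 (sum_geom_le M q0 q1)) _.
rewrite /s mulrAC ler_pdivrMr // -ler_pdivrMl //.
by apply: le_trans Dn; rewrite mulrC lerDr.
Qed.

(** w is the value of the series W of (1 - q)^(1/2). The coefficients of W after the first are
    nonpositive, while its partial sums, which are the coefficients of (1 - q)^(-1/2), are positive.
    So their absolute values sum to at most 1, and |w - 1| <= |z| < 1. *)
Lemma ev_half_coef_sqrt z : nm z < 1 -> exists w : C,
  [/\ ev half_coef z * w = 1, w ^+ 2 = 1 - z & 0 < complex.Re w].
Proof.
move=> z1; have [r [r0 r1 zr]] := between_nm z1.
pose W : nat -> R := fexp (fun=> - 2^-1).
have hW (k : nat) : `|- 2^-1 : R| <= 1%:R by rewrite normrN (half_le 0).
exists (ev W z); split.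
- exact: (@ev_fexpN (fun=> 2^-1) 1 z (fun=> half_le 0) z1).
- rewrite -(ev_fexp_natmul 2 hW) //.
  have -> : (fun k => 2 * - 2^-1) = (fun=> - 1) :> (nat -> R).
    by apply/funext => k; rewrite mulrN mulfV ?pnatr_eq0.
  rewrite fexp_oneN (@ev_fin _ _ _ 2) => [|[|[|k _]]//]; last by rewrite subrr.
  rewrite /psum !big_ord_recr big_ord0 /= add0r subr0 sub0r expr0 mulr1 expr1.
  by rewrite rmorph1 rmorphN1 mulN1r.
have psW k : \sum_(i < k.+1) W i = half_coef k.
  have -> : half_coef = conv W (fun=> 1).
    by rewrite -fexp_one -fexpD; congr fexp; apply/funext => j /=; field.
  by rewrite /conv; apply: eq_bigr => i _; rewrite mulr1.
have Vpos k : 0 < half_coef k.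
  elim/ltn_ind: k => -[|k] IH; first by rewrite /half_coef fexp0.
  have kp : 0 < k.+1%:R :> R by rewrite ltr0n.
  rewrite -(pmulr_rgt0 _ kp) -/(der half_coef k) /half_coef der_fexp /conv.
  rewrite big_ord_recl ltr_wpDr //.
    by apply: sumr_ge0 => i _; rewrite mulr_ge0 ?invr_ge0 // ltW // IH // ltnS leq_subr.
  by rewrite mulr_gt0 ?invr_gt0 // IH // ltnS leq_subr.
have Wneg k : W k.+1 <= 0.
  have kp : 0 < k.+1%:R :> R by rewrite ltr0n.
  rewrite -(pmulr_rle0 _ kp) -/(der W k) /W der_fexp convC /conv -mulr_suml -/W psW.
  by rewrite mulrN oppr_le0 mulr_ge0 ?invr_ge0 // ltW.
have Wsum N : \sum_(k < N) `|W k.+1| <= 1.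
  have := psW N; rewrite big_ord_recl /W fexp0 -/W => e.
  rewrite (eq_bigr (fun k : 'I_N => - W k.+1)) => [|k _]; last by rewrite ler0_norm.
  rewrite sumrN; have := Vpos N; rewrite -e => h.
  rewrite -subr_ge0 opprK ltW //.
have [A hA] := l1_le_fexp_ex hW (ltW r0) r1.
have h : nm (ev W z - 1) <= nm z.
  apply: clim_le (climB (evP hA (ltW zr)) (clim_cst 1)); exists 1%N => -[//|M] _.
  rewrite /psum big_ord_recl fexp0 expr0 mulr1 addrAC subrr add0r.
  apply: le_trans (nm_sum _ _ _) _; rewrite -[leRHS]mul1r.
  apply: le_trans (ler_wpM2r (nm_ge0 z) (Wsum M)); rewrite mulr_suml.
  apply: ler_sum => k _; rewrite nmM nm_real nmX ler_wpM2l // exprS ler_piMr ?nm_ge0 //.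
  by rewrite exprn_ile1 ?nm_ge0 // ltW.
have := le_lt_trans (le_trans (le_Re_nm _) h) z1.
by case: (ev W z) => a b /=; rewrite ltr_norml ltrBrDr addNr => /andP[].
Qed.

End Roots.

(** * Growth of Catalan numbers and uniform convergence of the roots *)

Section Limit.
Local Open Scope ring_scope.
Local Open Scope complex_scope.
Variable R : realType.
Local Notation C := R[i].

(** [ballot R n 0] is the n-th Catalan number; its classical recursion is the case j = 0 of
    [ballot_rec]. *)
Lemma ballot0_rec n : 2 * n.*2.+1%:R * ballot R n 0 = n.+2%:R * ballot R n.+1 0.
Proof.
have := ballot_rec R n 0; rewrite muln0 mul0r subr0 => h.
have nz : n.+1%:R != 0 :> R by rewrite pnatr_eq0.
apply: (mulfI nz); rewrite !mulrA -[_ * n.+2%:R]natrM -h.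
by rewrite !natrM; ring.
Qed.

Lemma ballot0_le n : ballot R n 0 <= 4 ^+ n.
Proof.
elim: n => [|n IH]; first by rewrite /ballot bin0 bin_small // subr0.
have p : 0 < n.+2%:R :> R by rewrite ltr0n.
rewrite -(ler_pM2l p) -ballot0_rec exprS mulrA; apply: ler_pM => //.
- by rewrite mulr_ge0.
- exact: ltW (ballot0_gt0 _ _).
- by rewrite -!natrM ler_nat; lia.
Qed.

(** A polynomial loss against 4^n disappears in the 2n-th root. The induction runs with the smaller
    factor (n + 1) (2n + 1). *)
Lemma ballot0_ge n : 4 ^+ n <= n.*2.+1%:R ^+ 2 * ballot R n 0.
Proof.
suff h : 4 ^+ n <= (n.+1 * n.*2.+1)%:R * ballot R n 0.
  apply: le_trans h _; rewrite ler_wpM2r ?(ltW (ballot0_gt0 _ _)) // -natrX ler_nat expnS expn1.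
  by rewrite leq_mul2r -addnn; lia.
elim: n => [|n IH]; first by rewrite /ballot bin0 bin_small // subr0 mulr1.
have -> : (n.+2 * n.+1.*2.+1)%:R * ballot R n.+1 0 = n.+1.*2.+1%:R * (2 * n.*2.+1%:R * ballot R n 0).
  by rewrite ballot0_rec natrM; ring.
have -> : n.+1.*2.+1%:R * (2 * n.*2.+1%:R * ballot R n 0) = (n.+1.*2.+1 * 2 * n.*2.+1)%:R * ballot R n 0.
  by rewrite !natrM; ring.
rewrite exprS; apply: le_trans (ler_wpM2l _ IH) _ => //; rewrite mulrA ler_wpM2r //.
  by rewrite ltW // ballot0_gt0.
by rewrite -natrM ler_nat; nia.
Qed.

Definition root_cst n : R := ballot R n 0 `^ (n.*2%:R)^-1.

Lemma root_cst_gt0 n : 0 < root_cst n.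
Proof. by rewrite powR_gt0 // ballot0_gt0. Qed.

Lemma root_cstX n : (0 < n)%N -> root_cst n ^+ n.*2 = ballot R n 0.
Proof.
move=> n0; rewrite -powR_mulrn ?ltW ?root_cst_gt0 // -powRrM mulVf ?powRr1 //.
  by rewrite ltW // ballot0_gt0.
by rewrite pnatr_eq0 double_eq0 -lt0n.
Qed.

Lemma root_cst_le2 n : (0 < n)%N -> root_cst n <= 2.
Proof.
move=> n0; rewrite -(@ler_pXn2r _ n.*2) ?double_gt0 ?nnegrE ?(ltW (root_cst_gt0 n)) //.
rewrite root_cstX // -mul2n exprM; apply: le_trans (ballot0_le n) _.
by have -> : 2 ^+ 2 = 4 :> R by rewrite -natrX.
Qed.

(** If the root were at most 2 - 2d, then 4^n <= (2n + 1)^2 4^n (1 - d)^(2n), which fails for n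
    large. *)
Lemma root_cst_cvg (e : R) : 0 < e -> exists N, forall n, (N <= n)%N -> `|root_cst n - 2| <= e.
Proof.
move=> e0; pose d := Num.min (e / 2) 2^-1.
have d0 : 0 < d by rewrite lt_min !divr_gt0 // invr_gt0 ltr0n.
have de : 2 * d <= e by rewrite mulrC -ler_pdivlMr // ge_min lexx.
have d1 : d <= 2^-1 by rewrite ge_min lexx orbT.
have d1' : 0 < 1 - d.
  by rewrite subr_gt0; apply: le_lt_trans d1 _; rewrite invf_lt1 ?ltr1n.
(* Strictly between 1 - d and 1: (2n + 1)^2 t^(2n) stays bounded by [l1_le_sqr], and the ratio (1 -
   d) / t supplies the decay. *)
pose t := (1 - d + 1) / 2.
have dt : 1 - d < t by rewrite midf_lt // gtrBl.
have t1 : t < 1 by rewrite midf_lt // gtrBl.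
have t0 : 0 < t by apply: lt_trans dt.
have hB := l1_le_sqr (ltW t0) t1; set B := 2 * _ in hB.
have half0 : 0 < 2^-1 :> R by rewrite invr_gt0.
have [||N hN] := @expr_small R ((1 - d) / t) B 2^-1 _ _ half0.
- by rewrite divr_ge0 // ltW.
- by rewrite ltr_pdivrMr // mul1r.
exists N.+1 => n hn; have n0 : (0 < n)%N by apply: leq_trans hn.
have c2 := root_cst_le2 n0; have c0 := root_cst_gt0 n.
rewrite ler0_norm ?subr_le0 // opprB; apply: le_trans de.
rewrite lerBlDr addrC -lerBlDr; apply/ltW; rewrite ltNge; apply/negP => hle.
have hX : 4 ^+ n <= n.*2.+1%:R ^+ 2 * (4 ^+ n * (1 - d) ^+ n.*2).
  apply: le_trans (ballot0_ge n) _; rewrite ler_wpM2l ?exprn_ge0 // -root_cstX //.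
  have -> : 4 ^+ n * (1 - d) ^+ n.*2 = (2 - 2 * d) ^+ n.*2.
    have -> : 2 - 2 * d = 2 * (1 - d) by ring.
    rewrite exprMn; congr (_ * _).
    by rewrite -mul2n exprM; congr (_ ^+ _); rewrite -natrX.
  by rewrite lerXn2r ?nnegrE // ltW // (lt_le_trans c0).
have : n.*2.+1%:R ^+ 2 * (1 - d) ^+ n.*2 <= 2^-1.
  have Nn : (N <= n.*2)%N by rewrite -addnn (leq_trans (ltnW hn)) // leq_addr.
  refine (le_trans _ (hN _ Nn)).
  rewrite expr_div_n [leRHS]mulrAC ler_pdivlMr ?exprn_gt0 //.
  have := l1_le_coef n.*2 (ltW t0) hB; rewrite ger0_norm ?exprn_ge0 // => h.
  by rewrite [_ ^+ 2 * _]mulrC -mulrA ler_wpM2l ?exprn_ge0 ?(ltW d1').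
move: hX; rewrite mulrCA -{1}[4 ^+ n]mulr1 ler_pM2l ?exprn_gt0 // => h1 h2.
have := le_trans h1 h2; rewrite leNgt invf_lt1 ?ltr1n //.
Qed.

Lemma root_cvg (r e : R) : 0 <= r -> r < 1 -> 0 < e ->
  exists N, forall n, (N <= n)%N -> forall z w : C, nm z <= r -> ev (@half_coef R) z * w = 1 ->
    nm ((root_cst n)%:C * ev (root_coef R n) z - 2 / w) <= e.
Proof.
move=> r0 r1 e0.
have [A hA] := @l1_le_fexp_ex R (fun=> 2^-1) 1 r (fun=> half_le R 0) r0 r1.
have A0 := l1_le_ge0 hA; have A1 : 0 < A + 1 by rewrite ltr_wpDl.
(* The difference is v ((c - 2) (U - 1) + (c - 2) + 2 (U - 1)), at most A (d + d + 2d) as d <= 1; A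
   + 1 instead of A keeps the denominator positive. *)
pose d := Num.min 1 (e / (4 * (A + 1))).
have d0 : 0 < d by rewrite lt_min ltr01 divr_gt0 // mulr_gt0.
have [N hN] := root_cst_cvg d0; have [M hM] := root_exp_cvg r0 r1 d0.
exists (maxn N M) => n; rewrite geq_max => /andP[/hN cn /hM Un] z w zr vw.
have {Un} := Un z zr; have z1 := le_lt_trans zr r1; have hv := nm_ev_le hA zr.
rewrite ev_root_coefE // -/(half_coef R) in hv *.
set U := ev _ z; set v := ev _ z in vw hv *; set c := root_cst n in cn *.
have w0 : w != 0 by apply: contraTneq (oner_neq0 C) => w0; rewrite -vw w0 mulr0 eqxx.
have -> : 2 / w = 2 * v by apply: (mulIf w0); rewrite divfK // -mulrA vw mulr1.
move=> hU.
have -> : c%:C * (U * v) - 2 * v = v * ((c - 2)%:C * (U - 1) + (c - 2)%:C + 2 * (U - 1)).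
  by rewrite rmorphB (rmorph_nat (real_complex R)); ring.
have n2 : nm (2 : C) = 2 by rewrite -(rmorph_nat (real_complex R)) nm_real normr_nat.
rewrite nmM; apply: (@le_trans _ _ (A * (4 * d))).
  apply: ler_pM; rewrite ?nm_ge0 //.
  have -> : 4 * d = 1 * d + d + 2 * d by ring.
  apply: le_trans (nmD _ _) _; apply: lerD; last by rewrite nmM n2 ler_wpM2l.
  apply: le_trans (nmD _ _) _; rewrite nmM nm_real; apply: lerD => //.
  by apply: ler_pM; rewrite ?nm_ge0 // (le_trans cn) // ge_min lexx.
rewrite mulrCA mulrA; apply: (@le_trans _ _ ((4 * (A + 1)) * d)).
  by rewrite ler_wpM2r ?(ltW d0) // ler_wpM2l // lerDl.
by rewrite mulrC -ler_pdivlMr ?mulr_gt0 // ge_min lexx orbT.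
Qed.

End Limit.


(** * Evaluation of the numerators, analyticity and square roots *)

Section TouchardRiordanSum.
Local Open Scope ring_scope.
Local Open Scope complex_scope.
Variable R : realType.

Lemma fpoly_horner n (z : R[i]) : (ballot R n 0)%:C * (fpoly R n).[z] =
  \sum_(j < n.+1) (-1) ^+ j * z ^+ tri j * (ballot R n j)%:C.
Proof.
rewrite -ev_rballot (@ev_fin _ _ _ (tri n).+1); last exact: tricoef_rballot_small.
rewrite /psum mulr_sumr.
have e k : (k < (tri n).+1)%N -> (ballot R n 0)%:C * ((tricoef (rballot R n) k)%:C * z ^+ k) =
    \sum_(j < (tri n).+1 | tri j == k) (-1) ^+ j * z ^+ tri j * (ballot R n j)%:C.
  move=> kn; rewrite (tricoef_widen _ kn) rmorph_sum mulr_suml mulr_sumr.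
  apply: eq_bigr => j /eqP jk; rewrite /rballot -jk.
  have b0 : ballot R n 0 != 0 by rewrite gt_eqF // ballot0_gt0.
  rewrite mulrA -rmorphM [RHS]mulrAC; congr (_ * _).
  by rewrite mulrCA mulrC [_ * (_ / _)]mulrC divfK // mulrC rmorphM rmorphXn rmorphN1.
rewrite (eq_bigr _ (fun (k : 'I_(tri n).+1) _ => e k (ltn_ord k))) (exchange_big_dep predT) //=.
rewrite [RHS](big_ord_widen _ (fun j => (-1) ^+ j * z ^+ tri j * (ballot R n j)%:C) (_ : n.+1 <= (tri n).+1)%N);
  last by rewrite ltnS leq_tri.
rewrite [RHS]big_mkcond; apply: eq_bigr => j _; case: ltnP => [jn|nj]; last first.
  by rewrite big1 // => k _; rewrite ballot_small // mulr0.
have tj : (tri j < (tri n).+1)%N by have := tri_double j; have := tri_double n; nia.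
by rewrite (big_pred1 (Ordinal tj)) // => k; rewrite /= -val_eqE /= eq_sym.
Qed.

Lemma wsum_ballot (q : R) n : (1 - q) ^+ n * wsum q n.*2 n.*2 0 =
  \sum_(j < n.+1) (-1) ^+ j * q ^+ tri j * ballot R n j.
Proof. exact: wsum_touchard_riordan. Qed.

Lemma ev_analytic (a : nat -> R) (c z : R[i]) :
  (forall r, 0 < r -> r < 1 -> exists B, l1_le a r B) -> nm z < 1 ->
  exists2 y : R, 0 < y & exists A : nat -> R[i], forall h, nm h < y ->
    clim (fun N => \sum_(k < N) A k * h ^+ k) (c * ev a (z + h)).
Proof.
move=> ha z1; pose y := (1 - nm z) / 4.
have y0 : 0 < y by rewrite divr_gt0 // subr_gt0.
have e : nm z + 2 * y = (1 + nm z) / 2 by rewrite /y; field.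
have [||B hB] := ha (nm z + 2 * y).
- by rewrite e divr_gt0 // ltr_wpDr ?nm_ge0.
- by rewrite e ltr_pdivrMr // mul1r -[ltRHS]/(1 + 1) ltrD2l.
exists y => //; exists (fun k => c * ev (shift_coef a k) z) => h hy.
have := climZ c (ev_reexpand y0 hB hy) => lim e0 /lim[N hN]; exists N => n /hN.
by rewrite mulr_sumr; under eq_bigr do rewrite mulrA.
Qed.

(** For w = a + ib, the modulus of w^2 is a^2 + b^2 and its real part is a^2 - b^2, the data that
    enter [Csqrt]. *)
Lemma sqrt_half_sum (a b : R) : Num.sqrt ((a ^+ 2 + b ^+ 2 + (a * a - b * b)) / 2) = `|a|.
Proof. by rewrite -sqrtr_sqr; congr Num.sqrt; field. Qed.

Lemma sqrt_half_sub (a b : R) : Num.sqrt ((a ^+ 2 + b ^+ 2 - (a * a - b * b)) / 2) = `|b|.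
Proof. by rewrite -sqrtr_sqr; congr Num.sqrt; field. Qed.

(** a b + b a is the imaginary part of (a + ib)^2; for a > 0 it has the sign of b, which is what
    [Csqrt] tests. *)
Lemma sign_norm (a b : R) : 0 < a ->
  (0 <= a * b + b * a -> `|b| = b) /\ (~ (0 <= a * b + b * a) -> `|b| = - b).
Proof.
move=> a0; have -> : a * b + b * a = (2 * a) * b by ring.
have p : 0 < 2 * a by rewrite mulr_gt0.
rewrite pmulr_rge0 //; split=> [|/negP]; first exact: ger0_norm.
by rewrite -ltNge => /ltr0_norm.
Qed.

(** These radii exhaust the open disk and give the open cover to which compactness is applied. *)
Lemma disk_radius (z : R[i]) : nm z < 1 -> exists i : nat, nm z < 1 - i.+1%:R^-1.
Proof.
move=> z1; have p : 0 < 1 - nm z by rewrite subr_gt0.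
exists (Num.truncn (1 - nm z)^-1).
rewrite ltrBrDr -ltrBrDl -[ltRHS]invrK ltf_pV2 ?posrE ?invr_gt0 ?ltr0n //.
exact: truncnS_gt.
Qed.

End TouchardRiordanSum.

From mathcomp Require Import Rstruct.
From Stdlib Require Import Reals.
From Stdlib Require Znat.

(** * Translation between pairs of reals and [R[i]] *)

Section ComplexBridge.
Local Open Scope ring_scope.
Local Open Scope complex_scope.
Local Notation R := Rdefinitions.R.
Implicit Types (z w : Cx) (u v : R[i]).

Definition ofCx z : R[i] := Complex z.1 z.2.
Definition toCx u : Cx := (complex.Re u, complex.Im u).

Lemma toCxK u : ofCx (toCx u) = u. Proof. by case: u. Qed.

Lemma CaddE z w : Cadd z w = toCx (ofCx z + ofCx w). Proof. by case: z w => ? ? []. Qed.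
Lemma CsubE z w : Csub z w = toCx (ofCx z - ofCx w). Proof. by case: z w => ? ? []. Qed.
Lemma CmulE z w : Cmul z w = toCx (ofCx z * ofCx w). Proof. by case: z w => ? ? []. Qed.
Lemma CreE (x : R) : Cre x = toCx x%:C. Proof. by []. Qed.
Lemma CnormE z : Cnorm z = nm (ofCx z).
Proof. by rewrite /Cnorm RsqrtE nmE /= !expr2. Qed.
Lemma CpowE z k : Cpow z k = toCx (ofCx z ^+ k).
Proof. by elim: k => [|k IH] //; rewrite exprS [Cpow _ _]/= IH CmulE toCxK. Qed.
Lemma CinvE z : Cinv z = toCx (ofCx z)^-1.
Proof. by case: z => x y; rewrite /Cinv /toCx /ofCx /= !RdivE !expr2 mulNr. Qed.
Lemma CdivE z w : Cdiv z w = toCx (ofCx z / ofCx w).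
Proof. by rewrite /Cdiv CmulE CinvE toCxK. Qed.
Lemma CsumE f m : Csum f m = toCx (\sum_(k < m) ofCx (f k)).
Proof. by elim: m => [|m IH]; rewrite ?big_ord0 // big_ord_recr /= IH CaddE toCxK. Qed.

Lemma in_diskE z : in_disk z <-> nm (ofCx z) < 1.
Proof. by rewrite /in_disk CnormE; split=> [/RltP|h]; last apply/RltP. Qed.

Lemma clim_Un_cv (f : nat -> Cx) (l : Cx) : clim (fun n => ofCx (f n)) (ofCx l) ->
  Un_cv (fun n => Cnorm (Csub (f n) l)) 0%R.
Proof.
move=> h e /Rlt_gt/RltP e0; have [N hN] := h _ e0; exists N => n /ssrnat.leP /hN hn.
apply/RltP; rewrite RdistE R0E subr0 CnormE CsubE toCxK ger0_norm ?nm_ge0 //.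
Qed.

Lemma analytic_toCx (a : nat -> R) (c : R) :
  (forall r : R, 0 < r -> r < 1 -> exists B, l1_le a r B) ->
  analytic_on_disk (fun z => toCx (c%:C * ev a (ofCx z))).
Proof.
move=> ha z0 /in_diskE z01; have [y y0 [A hA]] := ev_analytic c%:C ha z01.
exists y; split; first exact/RltP.
exists (fun k => toCx (A k)) => z /RltP; rewrite CnormE => zy.
apply: clim_Un_cv; rewrite toCxK.
have -> : ofCx z = ofCx z0 + ofCx (Csub z z0) by rewrite CsubE toCxK addrC subrK.
move=> e /(hA _ zy)[N hN]; exists N => n /hN.
move=> hn; rewrite CsumE toCxK; apply: le_lt_trans hn.
rewrite le_eqVlt; apply/predU1P; left; congr (nm (_ - _)).
by apply: eq_bigr => k _; rewrite CmulE !toCxK CpowE toCxK.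
Qed.

End ComplexBridge.

(** * The Touchard-Riordan expression and its analytic root *)

Section Assembly.
Local Open Scope ring_scope.
Local Open Scope complex_scope.
Local Notation R := Rdefinitions.R.
Implicit Types (q z : Cx) (n : nat).

(** k (k - 1) is symmetric about 1/2, so k = - i and k = i + 1 give the same exponent. *)
Lemma TR_exponents i :
  [/\ Z.to_nat (- Z.of_nat i * (- Z.of_nat i - 1) / 2) = tri i,
      Z.to_nat (Z.of_nat i.+1 * (Z.of_nat i.+1 - 1) / 2) = tri i,
      Z.abs_nat (- Z.of_nat i) = i & Z.abs_nat (Z.of_nat i) = i].
Proof.
have e : (Z.of_nat i * (Z.of_nat i + 1) = Z.of_nat (tri i) * 2)%Z.
  by have := tri_double i; lia.
split; [| | lia | lia].
- have -> : (- Z.of_nat i * (- Z.of_nat i - 1) = Z.of_nat (tri i) * 2)%Z by lia.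
  by rewrite Z.div_mul // Znat.Nat2Z.id.
- have -> : (Z.of_nat i.+1 * (Z.of_nat i.+1 - 1) = Z.of_nat (tri i) * 2)%Z by lia.
  by rewrite Z.div_mul // Znat.Nat2Z.id.
Qed.

(** The sum is split at j = n. For k = - i and k = i + 1 the powers of q agree and the signs are
    opposite, so the two binomials combine into a ballot number. *)
Lemma TR_numerator (K : comNzRingType) (z : K) n :
  let F j := (-1) ^+ Z.abs_nat (Z.of_nat j - Z.of_nat n) * 'C(n.*2, j)%:R *
    z ^+ Z.to_nat ((Z.of_nat j - Z.of_nat n) * (Z.of_nat j - Z.of_nat n - 1) / 2) in
  \sum_(j < n.*2.+1) F j =
  \sum_(j < n.+1) (-1) ^+ j * z ^+ tri j * ('C(n.*2, n + j)%:R - 'C(n.*2, (n + j).+1)%:R).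
Proof.
move=> F.
have Fneg i : (i < n)%nat -> F (n - i.+1)%nat = (-1) ^+ i.+1 * z ^+ tri i.+1 * 'C(n.*2, n + i.+1)%:R.
  move=> hi; have [e1 _ e3 _] := TR_exponents i.+1.
  have e : (Z.of_nat (n - i.+1) - Z.of_nat n = - Z.of_nat i.+1)%Z by lia.
  rewrite /F e e1 e3 mulrAC; congr (_ * _%:R).
  by rewrite -bin_sub -?addnn; [congr 'C(_, _)|]; lia.
have Fpos i : F (n + i.+1)%nat = (-1) ^+ i.+1 * z ^+ tri i * 'C(n.*2, n + i.+1)%:R.
  have [_ e2 _ _] := TR_exponents i; have [_ _ _ e4] := TR_exponents i.+1.
  have e : (Z.of_nat (n + i.+1) - Z.of_nat n = Z.of_nat i.+1)%Z by lia.
  by rewrite /F e e2 e4 mulrAC.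
have F0 : F n = 'C(n.*2, n)%:R.
  by rewrite /F Z.sub_diag /= mul1r mulr1.
have -> : \sum_(j < n.*2.+1) F j = \sum_(j < n) F j + \sum_(j < n.+1) F (n + j)%nat.
  by rewrite -addnn -addnS big_split_ord.
rewrite (reindex_inj rev_ord_inj) /=.
rewrite (eq_bigr (fun i : 'I_n => (-1) ^+ i.+1 * z ^+ tri i.+1 * 'C(n.*2, n + i.+1)%:R)); last first.
  by move=> i _; exact: Fneg.
rewrite big_ord_recl /= addn0 F0.
rewrite [X in _ + (_ + X)](eq_bigr (fun i : 'I_n => (-1) ^+ i.+1 * z ^+ tri i * 'C(n.*2, n + i.+1)%:R)); last first.
  by move=> i _; exact: Fpos.
under [RHS]eq_bigr do rewrite mulrBr.
rewrite sumrB [X in _ = X - _]big_ord_recl [X in _ = _ - X]big_ord_recr /=.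
(* The half with k > 0 has one term less; the missing one would carry binom(2n, 2n + 1) = 0. *)
rewrite [X in _ = _ - (_ + X)](_ : _ = 0) ?addr0; last first.
  by rewrite bin_small ?mulr0 // -addnn.
rewrite addn0 expr0 mul1r (_ : tri 0 = 0%nat) // expr0 mul1r addrCA addrA; congr (_ + _).
rewrite -sumrN; apply: eq_bigr => i _.
by rewrite exprS mulN1r !mulNr addnS.
Qed.

Lemma TRE n q : TR n q = toCx ((ballot R n 0)%:C * (fpoly R n).[ofCx q] * (1 - ofCx q) ^- n).
Proof.
rewrite /TR CdivE CsumE CpowE !toCxK CsubE toCxK -[ofCx (1%R, 0%R)]/(1 : R[i]).
congr (toCx (_ / _)); rewrite fpoly_horner.
transitivity (\sum_(j < n.+1) (-1) ^+ j * ofCx q ^+ tri j *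
  ('C(n.*2, n + j)%:R - 'C(n.*2, (n + j).+1)%:R)); last first.
  by apply: eq_bigr => j _; rewrite rmorphB !rmorph_nat.
rewrite -TR_numerator /= mul2n addn1; apply: eq_bigr => j _.
rewrite CmulE toCxK CpowE toCxK; congr (_ * _).
rewrite INRE RpowE RmultE; change (ofCx (Cre ?x)) with (x%:C).
rewrite rmorphM rmorph_nat rmorphXn; congr (_ ^+ _ * _).
by rewrite rmorphN1.
Qed.

Lemma T_wsum n (x : R) : T n x = wsum x n.*2 n.*2 0.
Proof.
rewrite /T -mul2n -sum_pairings; apply: eq_bigr => P _; exact: RpowE.
Qed.


(** The constant restores the factor b_(n,0) by which f_n was normalised. *)
Definition tgamma n q : Cx := toCx ((root_cst R n)%:C * ev (root_coef R n) (ofCx q)).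

Lemma tgamma_analytic n : analytic_on_disk (tgamma n).
Proof.
apply: analytic_toCx => r r0 r1.
exact: l1_le_fexp_ex (@root_coef_exp_le R n) (ltW r0) r1.
Qed.

Lemma tgammaX n q : (0 < n)%nat -> in_disk q -> Cpow (tgamma n q) (2 * n) = TR n q.
Proof.
move=> n0 /in_diskE q1; rewrite CpowE toCxK TRE mul2n exprMn -rmorphXn root_cstX //.
by rewrite ev_root_coefX // mulrA.
Qed.

(** The Touchard-Riordan formula on the real interval: multiplied by (1 - x)^n, both sides are the
    signed sum of ballot numbers. *)
Lemma TR_real n (x : R) : nm (x%:C) < 1 -> TR n (Cre x) = Cre (T n x).
Proof.
move=> x1; rewrite TRE fpoly_horner T_wsum [Cre x]CreE toCxK [RHS]CreE.
have x1' : 1 - x != 0.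
  by apply: contraTneq x1 => /subr0_eq <-; rewrite nm1 ltxx.
congr toCx; transitivity (((1 - x) ^+ n * wsum x n.*2 n.*2 0 / (1 - x) ^+ n)%:C); last first.
  by rewrite mulrAC divff ?mul1r // expf_neq0.
rewrite wsum_ballot rmorphM fmorphV rmorphXn rmorphB rmorph1; congr (_ / _).
rewrite rmorph_sum; apply: eq_bigr => j _.
by rewrite !rmorphM !rmorphXn rmorphN1.
Qed.

(** Both values are positive 2n-th roots of [T n x]; positivity of the series comes from
    [ev_fexp_gt0]. *)
Lemma tgamma_real n (x : R) : (0 < n)%nat -> nm (x%:C) < 1 -> tgamma n (Cre x) = Cre (gamma n x).
Proof.
move=> n0 x1; have x1' : `|x| < 1 by rewrite -nm_real.
have [y y0 yE] := ev_fexp_gt0 (@root_coef_exp_le R n) x1'.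
have cy : 0 < root_cst R n * y by rewrite mulr_gt0 ?root_cst_gt0.
have e : tgamma n (Cre x) = Cre (root_cst R n * y).
  by rewrite /tgamma CreE toCxK /root_coef yE -rmorphM.
rewrite e /gamma; congr Cre.
have disk : in_disk (Cre x) by apply/in_diskE.
have := tgammaX n0 disk; rewrite e TR_real // CpowE CreE toCxK -rmorphXn => -[<-].
have c0 : (0 < root_cst R n * y)%R by apply/RltP.
have nz : INR (2 * n) <> 0%R.
  by apply: not_0_INR => /eqP; rewrite muln_eq0 /= -leqn0 leqNgt n0.
by rewrite -RpowE -(Rpower_pow _ _ c0) Rpower_mult Rinv_r // Rpower_1.
Qed.

(** The condition on the real part singles out the principal root: Im (w^2) = 2 Re w Im w then has
    the sign of Im w. *)
Lemma Csqrt_sqr (w : R[i]) : 0 < complex.Re w -> Csqrt (toCx (w ^+ 2)) = toCx w.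
Proof.
move=> w0; rewrite /Csqrt CnormE toCxK nmX !RsqrtE !RdivE.
case: w w0 => a b /= a0.
have -> : nm (Complex a b) ^+ 2 = a ^+ 2 + b ^+ 2.
  by rewrite nmE sqr_sqrtr // addr_ge0 ?sqr_ge0.
rewrite /toCx /=; congr pair; first by rewrite sqrt_half_sum gtr0_norm.
have [h1 h2] := sign_norm b a0.
rewrite sqrt_half_sub; case: Rle_dec => [le|lt] /=.
  by rewrite h1 ?RmultE ?mul1r //; apply/RleP.
by rewrite h2 => [|/RleP //]; rewrite RmultE mulrN -mulNr opprK mul1r.
Qed.

Lemma Cdiv_Csqrt q w : in_disk q -> w ^+ 2 = 1 - ofCx q -> 0 < complex.Re w ->
  Cdiv (Cre 2) (Csqrt (Csub (1%R, 0%R) q)) = toCx (2 / w).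
Proof.
move=> q1 wE w0; rewrite CsubE -[ofCx (1%R, 0%R)]/(1 : R[i]) -wE Csqrt_sqr // CdivE toCxK.
by congr (toCx (_ / _)); rewrite CreE toCxK -(rmorph_nat (real_complex R)).
Qed.

(** Both convergence claims reduce to this: a point q lies in the closed disk of radius |q|, and a
    compact set in some closed disk of radius below 1. *)
Lemma tgamma_cvg (r e : R) : 0 <= r -> r < 1 -> 0 < e -> exists N, forall n, (N <= n)%nat ->
  forall q, Cnorm q <= r ->
  Cnorm (Csub (tgamma n q) (Cdiv (Cre 2) (Csqrt (Csub (1%R, 0%R) q)))) < e.
Proof.
move=> r0 r1 e0; have e2 : 0 < e / 2 by rewrite divr_gt0.
have [N hN] := root_cvg r0 r1 e2; exists N => n Nn q.
rewrite CnormE => qr; have q1 : in_disk q by apply/in_diskE; apply: le_lt_trans r1.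
have [w [w1 w2 w3]] := ev_half_coef_sqrt (le_lt_trans qr r1).
rewrite (Cdiv_Csqrt q1 w2 w3) CnormE CsubE !toCxK.
by apply: le_lt_trans (hN n Nn _ _ qr w1) _; rewrite ltr_pdivrMr // ltr_pMr // ltr1n.
Qed.

(** Finitely many of the disks of radius 1 - 1 / (i + 1) cover K, and these disks are nested. *)
Lemma Ccompact_disk (K : Cx -> Prop) : Ccompact K -> (forall z, K z -> in_disk z) ->
  exists r : R, [/\ 0 <= r, r < 1 & forall z, K z -> Cnorm z <= r].
Proof.
move=> cK Kd.
pose U (i : nat) (z : Cx) := is_true (nm (ofCx z) < 1 - i.+1%:R^-1).
have [||l hl] := cK nat U.
- move=> i z Uz; exists (1 - i.+1%:R^-1 - nm (ofCx z)); split.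
    by apply/RltP; rewrite R0E subr_gt0.
  move=> w /RltP; rewrite CnormE CsubE toCxK /U => h.
  have -> : ofCx w = (ofCx w - ofCx z) + ofCx z by rewrite subrK.
  by apply: le_lt_trans (nmD _ _) _; rewrite -ltrBrDr.
- by move=> z /Kd/in_diskE/disk_radius.
have [r [r0 r1 hr]] : exists r : R, [/\ 0 <= r, r < 1 &
    forall i, List.In i l -> 1 - i.+1%:R^-1 <= r].
  elim: l {hl} => [|j l [r [r0 r1 hr]]]; first by exists 0; split; rewrite ?ltr01.
  exists (Num.max r (1 - j.+1%:R^-1)); split.
  - by rewrite le_max r0.
  - by rewrite gt_max r1 gtrBl invr_gt0 ltr0n.
  - by move=> i [<-|/hr h]; rewrite le_max ?lexx ?orbT // h.
exists r; split=> // z /hl[i [il Uz]].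
by rewrite CnormE; apply: le_trans (ltW Uz) (hr i il).
Qed.

End Assembly.


Open Scope R_scope.

Theorem theorem1 :
  exists g : nat -> Cx -> Cx,
    (forall n : nat, (1 <= n)%nat ->
       analytic_on_disk (g n) /\
       (forall q, in_disk q -> Cpow (g n q) (2 * n) = TR n q) /\
       (forall x : R, -1 < x < 1 -> g n (Cre x) = Cre (gamma n x))) /\
    (forall q, in_disk q ->
       Un_cv (fun n => Cnorm (Csub (g n q) (Cdiv (Cre 2) (Csqrt (Csub (1, 0) q))))) 0) /\
    (forall K : Cx -> Prop, Ccompact K -> (forall z, K z -> in_disk z) ->
       forall eps, 0 < eps -> exists N : nat, forall n, (N <= n)%nat -> forall q, K q ->
         Cnorm (Csub (g n q) (Cdiv (Cre 2) (Csqrt (Csub (1, 0) q)))) < eps).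
Proof.
exists tgamma; split=> [n n0|]; last split=> [q q1 e|K cK Kd e] /Rlt_gt/RltP e0.
- split; first exact: tgamma_analytic.
  split=> [q|x [x0 x1]]; first exact: tgammaX.
  apply: tgamma_real => //; rewrite nm_real -RabsE; apply/RltP; exact: Rabs_def1.
- have /in_diskE := q1; rewrite -CnormE => q1'.
  have [N hN] := tgamma_cvg (introT RleP (sqrt_pos _)) q1' e0.
  exists N => n /ssrnat.leP Nn; rewrite /Rdist Rminus_0_r Rabs_pos_eq; last exact: sqrt_pos.
  by apply/RltP; apply: hN.
- have [r [r0 r1 hr]] := Ccompact_disk cK Kd.
  have [N hN] := tgamma_cvg r0 r1 e0.
  by exists N => n Nn q /hr qr; apply/RltP; apply: hN.
Qed.
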